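(* Let $d\sigma$ be a $\Theta$-invariant measure on $\Sigma$. For all $F,G\in L^2(\Xi\times\Sigma)$ one has the orthogonality relations $$\langle M(F),M(G)\rangle_{\Xi\times\Sigma}=\langle F,G\rangle_{\Xi\times\Sigma}.$$ Thus the operator $M:L^2(\Xi\times\Sigma)\to L^2(\Xi\times\Sigma)$ is unitary.
   Context: $(\Xi,[\![\cdot,\cdot]\!])$ is a real symplectic vector space of finite dimension $2n$. $dX$ denotes the Lebesgue measure on $\Xi$ normalized so that the symplectic Fourier transform $(\mathcal F{\sf f})(X)=\int_\Xi e^{-i[\![X,Y]\!]}{\sf f}(Y)dY$ is unitary in $L^2(\Xi)$ (in symplectic coordinates, $(2\pi)^{-n}$ times the usual Lebesgue measure). $\Sigma$ is a locally compact Hausdorff space endowed with a continuous action $\Theta$ of the additive group $\Xi$ by homeomorphisms $\Theta_X:\Sigma\to\Sigma$, $X\in\Xi$. $d\sigma$ is a positive Radon measure on $\Sigma$ invariant under all $\Theta_X$. $L^2(\Xi\times\Sigma)\cong L^2(\Xi)\otimes L^2(\Sigma)$ is taken with respect to the product measure, with scalar product $\langle F,G\rangle_{\Xi\times\Sigma}:=\int_\Xi\int_\Sigma\overline{F(X,\sigma)}\,G(X,\sigma)\,dXd\sigma$. The canonical map on $L^2(\Xi\times\Sigma)$ is $M:=\mathfrak F\circ{\rm C}$, where $[{\rm C}(F)](X,\sigma):=F(X,\Theta_X(\sigma))$ and $\mathfrak F:=\mathcal F\otimes1$ is the partial symplectic Fourier transformation in the variable $X\in\Xi$. Formally, $[M(F)](X,\sigma)=\int_\Xi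 e^{-i[\![X,Y]\!]}F(Y,\Theta_Y(\sigma))\,dY$. *)

(* Defs.v *)
From HB Require Import structures.
From mathcomp Require Import all_boot all_order all_algebra.
From mathcomp Require Import complex.
From mathcomp Require Import all_classical all_reals all_analysis.

Set Implicit Arguments.
Unset Strict Implicit.
Unset Printing Implicit Defensive.

Import Order.TTheory GRing.Theory Num.Theory.
Import numFieldNormedType.Exports.
Import ComplexField.Normc.

Local Open Scope classical_set_scope.
Local Open Scope complex_scope.
Local Open Scope ring_scope.

(* [borel T] is [T] itself, seen as a measurable space with its Borel sets. *)
Notation borel T := (g_sigma_algebraType (@open T)).

Section ComplexL2.
Context d (T : measurableType d) (R : realType).
Variable mu : {measure set T -> \bar R}.
Implicit Types f g : T -> R[i].

Definition cmeasurable f : Prop :=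
  measurable_fun [set: T] (fun x => complex.Re (f x)) /\
  measurable_fun [set: T] (fun x => complex.Im (f x)).

Definition cintegral f : R[i] :=
  (\int[mu]_x complex.Re (f x)) +i* (\int[mu]_x complex.Im (f x)).

Definition L1 : set (T -> R[i]) :=
  [set f | cmeasurable f /\ (\int[mu]_x (normc (f x))%:E < +oo)%E].

Definition L2sqnorm f : \bar R := (\int[mu]_x (normc (f x) ^+ 2)%:E)%E.

(* Square-integrable functions; the Hilbert space L^2 is the quotient of this
   set by [ceq_ae]. *)
Definition L2 : set (T -> R[i]) :=
  [set f | cmeasurable f /\ (L2sqnorm f < +oo)%E].

Definition ceq_ae f g : Prop := {ae mu, forall x, f x = g x}.

Definition L2dot f g : R[i] := cintegral (fun x => conjc (f x) * g x).

End ComplexL2.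

(* Operators between L^2 spaces are represented by maps on functions that
   preserve square-integrability and pass to the quotient by a.e. equality;
   their values on functions outside L^2 are irrelevant. *)
Section L2Operators.
Context d1 d2 (T1 : measurableType d1) (T2 : measurableType d2) (R : realType).
Variables (mu1 : {measure set T1 -> \bar R}) (mu2 : {measure set T2 -> \bar R}).
Variable U : (T1 -> R[i]) -> (T2 -> R[i]).

Definition L2_linear : Prop :=
  [/\ forall f, L2 mu1 f -> L2 mu2 (U f),
      forall f g, L2 mu1 f -> L2 mu1 g ->
        ceq_ae mu1 f g -> ceq_ae mu2 (U f) (U g) &
      forall (a : R[i]) f g, L2 mu1 f -> L2 mu1 g ->
        ceq_ae mu2 (U (fun x => a * f x + g x)) (fun y => a * U f y + U g y)].

Definition L2_bounded_linear : Prop :=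
  L2_linear /\
  exists C : R, forall f, L2 mu1 f ->
    (L2sqnorm mu2 (U f) <= C%:E * L2sqnorm mu1 f)%E.

Definition L2_unitary : Prop :=
  [/\ L2_linear,
      forall f g, L2 mu1 f -> L2 mu1 g ->
        L2dot mu2 (U f) (U g) = L2dot mu1 f g &
      forall h, L2 mu2 h -> exists2 f, L2 mu1 f & ceq_ae mu2 (U f) h].

End L2Operators.

Section SymplecticSpace.
Variables (R : realType) (Xi : normedModType R).

(* On a finite-dimensional real vector space all norms define the same
   topology and Borel sets, so the norm of [Xi] plays no role beyond these. *)
Definition has_dimension (m : nat) : Prop :=
  exists e : {linear 'rV[R]_m -> Xi}, bijective e.

Definition is_symplectic_form (omega : Xi -> Xi -> R) : Prop :=
  [/\ forall X, scalar (omega X),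
      forall Y, scalar (omega ^~ Y),
      forall X, omega X X = 0 &
      forall X, (forall Y, omega X Y = 0) -> X = 0].

(* A nonzero translation-invariant Borel measure finite on compact sets, i.e.
   Lebesgue measure up to a positive constant when [Xi] is finite-dimensional;
   sigma-finiteness is then automatic. *)
Definition is_lebesgue (mu : {measure set (borel Xi) -> \bar R}) : Prop :=
  [/\ forall (X : Xi) (A : set (borel Xi)), measurable A ->
        mu ((fun Y : Xi => X + Y) @^-1` A) = mu A,
      forall K : set Xi, compact K -> (mu K < +oo)%E &
      mu [set: Xi] != 0%E].

Definition fourier_integral (mu : {measure set (borel Xi) -> \bar R})
    (omega : Xi -> Xi -> R) (f : Xi -> R[i]) (X : Xi) : R[i] :=
  cintegral mu (fun Y => (cos (omega X Y) -i* sin (omega X Y)) * f Y).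

(* The integral converges only for f in L^1; as usual, the transform on L^2 is
   the continuous operator that it defines on the dense subspace of functions
   in both L^1 and L^2.  This determines [Fou] up to a.e. equality. *)
Definition is_symplectic_fourier (mu : {measure set (borel Xi) -> \bar R})
    (omega : Xi -> Xi -> R) (Fou : (Xi -> R[i]) -> (Xi -> R[i])) : Prop :=
  L2_bounded_linear mu mu Fou /\
  forall f, L1 mu f -> L2 mu f -> ceq_ae mu (Fou f) (fourier_integral mu omega f).

End SymplecticSpace.

Section LocallyCompactSpace.
Variables (R : realType) (Sigma : ptopologicalType).

(* Inner regular on all Borel sets, as in Bourbaki and Schwartz: the
   convention matters only when the space is not sigma-compact, and this is
   the one under which [\x^] below is the product of Radon measures. *)
Definition is_radon (nu : {measure set (borel Sigma) -> \bar R}) : Prop :=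
  (forall K : set Sigma, compact K -> (nu K < +oo)%E) /\
  (forall A : set (borel Sigma), measurable A ->
    nu A = ereal_sup [set nu K | K in [set K : set Sigma | compact K /\ K `<=` A]]).

Variable Xi : normedModType R.

Definition is_continuous_action (Theta : Xi -> Sigma -> Sigma) : Prop :=
  [/\ forall s, Theta 0 s = s,
      forall X Y s, Theta (X + Y) s = Theta X (Theta Y s) &
      continuous (fun p : Xi * Sigma => Theta p.1 p.2)].

Definition is_invariant (Theta : Xi -> Sigma -> Sigma)
    (nu : {measure set (borel Sigma) -> \bar R}) : Prop :=
  forall (X : Xi) (A : set (borel Sigma)), measurable A ->
    nu (Theta X @^-1` A) = nu A.

End LocallyCompactSpace.

Section CanonicalMap.
Variables (R : realType) (Xi : normedModType R) (Sigma : ptopologicalType).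
Variable mu : {sigma_finite_measure set (borel Xi) -> \bar R}.
Variable nu : {measure set (borel Sigma) -> \bar R}.
Implicit Type F : Xi * Sigma -> R[i].

(* [mu \x^ nu] integrates along [Xi] first, hence needs no sigma-finiteness of
   [nu]; it coincides with [mu \x nu] when [nu] is sigma-finite. *)
Definition prod_measure :
    {measure set (borel Xi * borel Sigma)%type -> \bar R} := (mu \x^ nu)%E.

Definition is_tensor_id (U : (Xi -> R[i]) -> (Xi -> R[i]))
    (V : (Xi * Sigma -> R[i]) -> (Xi * Sigma -> R[i])) : Prop :=
  L2_bounded_linear prod_measure prod_measure V /\
  forall (f : Xi -> R[i]) (g : Sigma -> R[i]), L2 mu f -> L2 nu g ->
    ceq_ae prod_measure (V (fun p => f p.1 * g p.2))
                        (fun p => U f p.1 * g p.2).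

(* The operator U (x) 1 on L^2(Xi x Sigma), unique up to a.e. equality because
   simple tensors are total.  The value 0 is a default used only if there were
   no such operator. *)
Definition tensor_id (U : (Xi -> R[i]) -> (Xi -> R[i])) :
    (Xi * Sigma -> R[i]) -> (Xi * Sigma -> R[i]) :=
  xget (fun _ _ => 0) [set V | is_tensor_id U V].

Definition action_change (Theta : Xi -> Sigma -> Sigma) F : Xi * Sigma -> R[i] :=
  fun p => F (p.1, Theta p.1 p.2).

Definition canonical_map (Fou : (Xi -> R[i]) -> (Xi -> R[i]))
    (Theta : Xi -> Sigma -> Sigma) F : Xi * Sigma -> R[i] :=
  tensor_id Fou (action_change Theta F).

End CanonicalMap.

(* Main.v *)
(** The canonical map is [U (x) 1] composed with the change of variables
    [F (X, sigma) |-> F (X, Theta_X sigma)], where [U] is the Fourier transform, of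
    which only the unitarity on L^2(Xi) matters.

    [U (x) 1] acts fibrewise: [(U (x) 1) F (., sigma) = U (F (., sigma))] for almost
    every [sigma], so that Tonelli's theorem makes it isometric, and the same
    construction applied to the inverse of [U] makes it surjective.  A jointly measurable
    version of the right-hand side exists for indicators of rectangles; if
    [sum_k |F_k - F|^2] is finite, the pointwise limit of versions for [F_k] is a
    version for [F].  Rectangles of finite measure are total in L^2 even if [nu] is not
    sigma-finite, since a function in L^2 is carried by a sigma-finite set of [sigma]'s.

    The change of variables is unitary because [(X, sigma) |-> (X, Theta_X sigma)]
    preserves the product measure.  Without sigma-finiteness the order of integration
    cannot be exchanged directly, but it can over a compact rectangle [A x K] and its
    image, contained in [A x Theta (A x K)]; inner regularity of [nu] does the rest. *)

Require Import Defs.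
From HB Require Import structures.
From mathcomp Require Import all_boot all_order all_algebra.
From mathcomp Require Import finmap complex.
From mathcomp Require Import all_classical all_reals all_analysis.
From mathcomp Require Import measurable_realfun.
From mathcomp Require Import ring lra.

Set Implicit Arguments.
Unset Strict Implicit.
Unset Printing Implicit Defensive.

Import Order.TTheory GRing.Theory Num.Theory.
Import numFieldNormedType.Exports.

Local Open Scope classical_set_scope.
Local Open Scope ring_scope.

(** * Square-integrable complex functions *)

Section complex_squared_norm.
Variable R : realType.
Implicit Types z w a : R[i].

(** A polynomial in the real and imaginary parts, free of the square root in [normc], so that [ring]
    and [nra] settle the identities and bounds below. *)
Definition sqc z : R := complex.Re z ^+ 2 + complex.Im z ^+ 2.

Lemma sqcE z : ComplexField.Normc.normc z ^+ 2 = sqc z.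
Proof. by case: z => a b; rewrite /= sqr_sqrtr// addr_ge0 ?sqr_ge0. Qed.

Lemma sqc_ge0 z : 0 <= sqc z.
Proof. by rewrite addr_ge0 ?sqr_ge0. Qed.

Lemma sqcM z w : sqc (z * w) = sqc z * sqc w.
Proof. by case: z => a b; case: w => c d; rewrite /sqc /=; ring. Qed.

Lemma sqc_real (x : R) : sqc (real_complex R x) = x ^+ 2.
Proof. by rewrite /sqc /= expr0n addr0. Qed.

(** The right side exceeds the left by [sqc (z - w)], by the parallelogram law. *)
Lemma sqcD z w : sqc (z + w) <= 2 * (sqc z + sqc w).
Proof.
case: z => a b; case: w => c d; rewrite /sqc /=.
have := sqr_ge0 (a - c); have := sqr_ge0 (b - d); nra.
Qed.

Lemma sqc_eq0 z : sqc z = 0 -> z = 0.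
Proof.
case: z => a b /eqP; rewrite /sqc /= paddr_eq0 ?sqr_ge0//.
by rewrite !sqrf_eq0 => /andP[/eqP-> /eqP->].
Qed.

End complex_squared_norm.

Section L2_basics.
Context d (T : measurableType d) (R : realType).
Variable mu : {measure set T -> \bar R}.
Implicit Types f g h : T -> R[i].
Local Notation N := (L2sqnorm mu).

(** The shape of combination found in [L2_linear], used as the only vector operation: the difference
    [g - f] is [lin (-1) f g], in this order. *)
Definition lin (a : R[i]) f g : T -> R[i] := fun x => a * f x + g x.

Lemma measurable_sqc f : cmeasurable f -> measurable_fun setT (fun x => sqc (f x)).
Proof.
move=> [mr mi]; apply: measurable_funD; exact: measurable_funX.
Qed.

Lemma measurable_sqcE f : cmeasurable f ->
  measurable_fun setT (fun x => (sqc (f x))%:E).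
Proof. by move=> /measurable_sqc /measurable_EFinP. Qed.

Lemma L2sqnormE f : N f = (\int[mu]_x (sqc (f x))%:E)%E.
Proof. by apply: eq_integral => x _; rewrite sqcE. Qed.

Lemma L2sqnorm_ge0 f : (0 <= N f)%E.
Proof. by apply: integral_ge0 => x _; rewrite lee_fin sqr_ge0. Qed.

Lemma cmeasurable_lin a f g : cmeasurable f -> cmeasurable g ->
  cmeasurable (lin a f g).
Proof.
move=> [fr fi] [gr gi]; split.
- rewrite (_ : (fun x => _) = fun x => (complex.Re a * complex.Re (f x) -
    complex.Im a * complex.Im (f x)) + complex.Re (g x)); last first.
    by apply/funext => x; rewrite /lin; case: a => ? ?; case: (f x) => ? ?; case: (g x).
  by apply: measurable_funD => //; apply: measurable_funB; apply: measurable_funM.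
- rewrite (_ : (fun x => _) = fun x => (complex.Re a * complex.Im (f x) +
    complex.Im a * complex.Re (f x)) + complex.Im (g x)); last first.
    by apply/funext => x; rewrite /lin; case: a => ? ?; case: (f x) => ? ?; case: (g x).
  by apply: measurable_funD => //; apply: measurable_funD; apply: measurable_funM.
Qed.

Lemma cmeasurable_real (u : T -> R) : measurable_fun setT u ->
  cmeasurable (fun x => real_complex R (u x)).
Proof. by move=> mu'; split. Qed.

Lemma L2sqnorm_lin a f g : cmeasurable f -> cmeasurable g ->
  (N (lin a f g) <= 2%:E * ((sqc a)%:E * N f + N g))%E.
Proof.
move=> mf mg; rewrite !L2sqnormE.
rewrite -ge0_integralZl//; first last.
- by rewrite lee_fin sqc_ge0.
- by move=> x _; rewrite lee_fin sqc_ge0.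
- exact: measurable_sqcE.
rewrite -ge0_integralD//; first last.
- exact: measurable_sqcE.
- by move=> x _; rewrite lee_fin sqc_ge0.
- by apply: measurable_funeM; exact: measurable_sqcE.
- by move=> x _; rewrite -EFinM lee_fin mulr_ge0// sqc_ge0.
rewrite -ge0_integralZl//; first last.
- by move=> x _; rewrite adde_ge0// ?mule_ge0// lee_fin sqc_ge0.
- apply: emeasurable_funD; last exact: measurable_sqcE.
  by apply: measurable_funeM; exact: measurable_sqcE.
apply: ge0_le_integral => //.
- by move=> x _; rewrite lee_fin sqc_ge0.
- by apply: measurable_sqcE; exact: cmeasurable_lin.
- apply: measurable_funeM; apply: emeasurable_funD; last exact: measurable_sqcE.
  by apply: measurable_funeM; exact: measurable_sqcE.
- by move=> x _; rewrite -EFinM lee_fin -sqcM sqcD.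
Qed.

Lemma L2_lin a f g : L2 mu f -> L2 mu g -> L2 mu (lin a f g).
Proof.
move=> [mf f2] [mg g2]; split; first exact: cmeasurable_lin.
apply: (le_lt_trans (L2sqnorm_lin a mf mg)).
rewrite lte_mul_pinfty// ?lee_fin//.
rewrite lte_add_pinfty// lte_mul_pinfty// lee_fin; exact: sqc_ge0.
Qed.

Lemma L2sqnormZ a f : cmeasurable f ->
  N (fun x => a * f x) = ((sqc a)%:E * N f)%E.
Proof.
move=> mf; rewrite !L2sqnormE -ge0_integralZl//; first last.
- by rewrite lee_fin sqc_ge0.
- by move=> x _; rewrite lee_fin sqc_ge0.
- exact: measurable_sqcE.
by apply: eq_integral => x _; rewrite sqcM.
Qed.

Lemma cmeasurable0 : cmeasurable (fun=> 0 : R[i]) (T := T).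
Proof. by split; exact: measurable_cst. Qed.

Lemma L2sqnorm0 : N (fun=> 0) = 0%E.
Proof.
rewrite L2sqnormE integral0_eq// => x _.
by rewrite /sqc /= expr0n /= addr0.
Qed.

Lemma L2_0 : L2 mu (fun=> 0).
Proof. by split; [exact: cmeasurable0|rewrite L2sqnorm0]. Qed.

Lemma L2_fin_num f : L2 mu f -> N f \is a fin_num.
Proof. by move=> [_ f2]; rewrite ge0_fin_numE// L2sqnorm_ge0. Qed.

(** Turns equality almost everywhere into a vanishing norm, which isometries transport. *)
Lemma L2sqnorm_sub_eq0 f g : cmeasurable f -> cmeasurable g ->
  N (lin (-1) f g) = 0%E <-> ceq_ae mu f g.
Proof.
move=> mf mg.
have ml : measurable_fun setT (fun x => (sqc (lin (-1) f g x))%:E).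
  by apply: measurable_sqcE; exact: cmeasurable_lin.
rewrite L2sqnormE; split.
- move=> N0; have : (\int[mu]_x `|(sqc (lin (-1) f g x))%:E| = 0)%E.
    by rewrite -[RHS]N0; apply: eq_integral => x _; rewrite gee0_abs// lee_fin sqc_ge0.
  move=> /(ae_eq_integral_abs mu measurableT ml); apply: filterS => x /(_ I).
  move=> [] /sqc_eq0 /eqP; rewrite /lin mulN1r addrC subr_eq0 => /eqP ->//.
- move=> fg; have -> : 0%E = (\int[mu]_x (cst 0%E) x)%E by rewrite integral0.
  apply: ae_eq_integral => //; move: fg; apply: filterS => x fgx _.
  by rewrite /lin fgx mulN1r addNr /sqc /= expr0n /= addr0.
Qed.

Lemma L2sqnorm_ae f g : cmeasurable f -> cmeasurable g -> ceq_ae mu f g -> N f = N g.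
Proof.
move=> mf mg fg; rewrite !L2sqnormE; apply: ge0_ae_eq_integral => //.
- exact: measurable_sqcE.
- exact: measurable_sqcE.
- by move=> x _; rewrite lee_fin sqc_ge0.
- by move=> x _; rewrite lee_fin sqc_ge0.
- by move: fg; apply: filterS => x -> _.
Qed.

Lemma integrable_sqc f : L2 mu f -> mu.-integrable setT (EFin \o (fun x => sqc (f x))).
Proof.
move=> [mf f2]; apply/integrableP; split; first exact: measurable_sqcE.
under eq_integral do rewrite /= ger0_norm ?sqc_ge0//.
by rewrite -L2sqnormE.
Qed.

(** The polarization identity, which reduces preservation of scalar products to preservation of
    norms. Square-integrability makes the four norms finite, so that the integrals may be
    subtracted. *)
Lemma L2dot_polar f g : L2 mu f -> L2 mu g ->
  L2dot mu f g =
  (((fine (N (lin 1 g f)) - fine (N (lin (-1) g f))) / 4) +i*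
   ((fine (N (lin (- 'i%C) g f)) - fine (N (lin 'i%C g f))) / 4))%C.
Proof.
move=> f2 g2; rewrite /L2dot /cintegral.
have i c : mu.-integrable setT (EFin \o (fun x => sqc (lin c g f x))).
  exact/integrable_sqc/L2_lin.
have iB a b : mu.-integrable setT
    (EFin \o (fun x => sqc (lin a g f x) - sqc (lin b g f x))).
  exact: (integrableB measurableT (i a) (i b)).
have key a b : fine (N (lin a g f)) - fine (N (lin b g f)) =
   (\int[mu]_x (sqc (lin a g f x) - sqc (lin b g f x)))%R.
  by rewrite RintegralB// !L2sqnormE.
rewrite !key -!RintegralZr//.
congr (_ +i* _)%C; apply: eq_Rintegral => x _; rewrite /lin;
  case: (f x) => a b; case: (g x) => a' b'; by rewrite /sqc /=; field.
Qed.

End L2_basics.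

Arguments lin {d T R} a%_R (f g)%_function_scope x.

(** * Tonelli's theorem without sigma-finiteness of the second factor *)

Section nonneg_measurable_ind.
Context d (T : measurableType d) (R : realType).
Variable P : (T -> R) -> Prop.
Import HBNNSimple.

Hypothesis P_indic : forall A, measurable A -> P \1_A.
Hypothesis P_scale : forall (c : R) (f : T -> R), 0 <= c -> measurable_fun setT f ->
  (forall x, 0 <= f x) -> P f -> P (fun x => c * f x).
Hypothesis P_add : forall f g : T -> R, measurable_fun setT f -> measurable_fun setT g ->
  (forall x, 0 <= f x) -> (forall x, 0 <= g x) -> P f -> P g ->
  P (fun x => f x + g x).
Hypothesis P_lim : forall (f_ : nat -> T -> R) (f : T -> R),
  (forall n, measurable_fun setT (f_ n)) -> (forall n x, 0 <= f_ n x) ->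
  (forall x, {homo f_^~ x : m n / (m <= n)%N >-> m <= n}) ->
  (forall x, f_^~ x @ \oo --> f x) -> measurable_fun setT f ->
  (forall n, P (f_ n)) -> P f.

(** The usual passage from indicators through simple functions to monotone limits; it serves for
    Tonelli's theorem, for density and for inner regularity. As [f] is real-valued, its simple
    approximations converge in [R] and not merely in the extended reals. *)
Lemma nonneg_measurable_ind (f : T -> R) :
  measurable_fun setT f -> (forall x, 0 <= f x) -> P f.
Proof.
move=> mf f0.
have msum (A : R -> set T) (s : seq R) : (forall y, measurable (A y)) ->
    measurable_fun setT (fun x => \sum_(y <- s) y * (\1_(A y) x : R)).
  by move=> mA; apply: measurable_sum => y; apply: measurable_funM.
have P_sum (A : R -> set T) (s : seq R) : (forall y, measurable (A y)) ->
    (forall y, y \in s -> 0 <= y) ->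
    P (fun x => \sum_(y <- s) y * \1_(A y) x).
  move=> mA; elim: s => [|y s ih] s0.
    rewrite (_ : (fun _ => _) = \1_set0); first exact: P_indic.
    by apply/funext => x; rewrite big_nil indic0.
  rewrite (_ : (fun _ => _) =
      fun x => y * \1_(A y) x + \sum_(z <- s) z * \1_(A z) x); last first.
    by apply/funext => x; rewrite big_cons.
  have y0 : 0 <= y by rewrite s0// mem_head.
  apply: P_add => //.
  - by apply: measurable_funM.
  - exact: msum.
  - by move=> x; rewrite mulr_ge0.
  - move=> x; rewrite big_seq sumr_ge0// => z zs.
    by rewrite mulr_ge0// s0// in_cons zs orbT.
  - by apply: P_scale => //; exact: P_indic.
  - by apply: ih => z zs; rewrite s0// in_cons zs orbT.
have mEf : measurable_fun setT (EFin \o f) by exact/measurable_EFinP.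
pose g := nnsfun_approx measurableT mEf.
apply: (P_lim (f_ := fun n => g n : T -> R)) => //.
- by move=> x m n mn; exact/lefP/nd_nnsfun_approx.
- move=> x; have : EFin \o g^~ x @ \oo --> (EFin \o f) x.
    by apply: cvg_nnsfun_approx => // y _; rewrite lee_fin.
  by move/fine_cvgP => [].
- move=> n.
  rewrite (_ : (g n : T -> R) = fun x => \sum_(y <- fset_set (range (g n)))
      y * \1_(g n @^-1` [set y]) x); last first.
    by apply/funext => x; rewrite fimfunE fsbig_finite.
  apply: P_sum => // y.
  by rewrite in_fset_set// inE => -[x _ <-].
Qed.

End nonneg_measurable_ind.

Section product.
Context d1 d2 (T1 : measurableType d1) (T2 : measurableType d2) (R : realType).
Variable m1 : {sigma_finite_measure set T1 -> \bar R}.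
Variable m2 : {measure set T2 -> \bar R}.

(* [prod_measure] for arbitrary measurable spaces. *)
Definition prodm : {measure set (T1 * T2)%type -> \bar R} := (m1 \x^ m2)%E.

Lemma prodmX A B : measurable A -> measurable B ->
  prodm (A `*` B) = (m1 A * m2 B)%E.
Proof. exact: product_measure2E. Qed.

Local Open Scope ereal_scope.

Lemma measurable_integral_ysection (f : T1 * T2 -> \bar R) :
  measurable_fun setT f -> (forall p, 0 <= f p) ->
  measurable_fun setT (fun y => \int[m1]_x f (x, y)).
Proof. exact: measurable_fun_fubini_tonelli_G. Qed.

(** For indicators the equality is the definition of [\x^], which integrates the [m1]-measure of
    sections against [m2]; additivity and monotone convergence do the rest and hold for every
    [m2]. *)
Lemma tonelli_prodm (f : T1 * T2 -> R) : measurable_fun setT f ->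
  (forall p, (0 <= f p)%R) ->
  \int[prodm]_p (f p)%:E = \int[m2]_y \int[m1]_x (f (x, y))%:E.
Proof.
have msec (g : T1 * T2 -> R) : measurable_fun setT g -> (forall p, (0 <= g p)%R) ->
    measurable_fun setT (fun y => \int[m1]_x (g (x, y))%:E).
  move=> mg g0; apply: (measurable_integral_ysection (f := EFin \o g)).
    exact/measurable_EFinP.
  by move=> p; rewrite lee_fin.
have m1sec (g : T1 * T2 -> R) y : measurable_fun setT g ->
    measurable_fun setT (fun x => (g (x, y))%:E).
  move=> mg; apply/measurable_EFinP.
  exact: (measurableT_comp mg (pair2_measurable y)).
have sec0 (g : T1 * T2 -> R) y : (forall p, (0 <= g p)%R) ->
    0 <= \int[m1]_x (g (x, y))%:E.
  by move=> g0; apply: integral_ge0 => x _; rewrite lee_fin.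
move: f; apply: nonneg_measurable_ind.
- move=> A mA; rewrite integral_indic// setIT.
  by rewrite /prodm /= /product_measure2 -(indic_fubini_tonelli_GE m1 mA).
- move=> c f c0 mf f0 Pf.
  transitivity (\int[prodm]_p (c%:E * (f p)%:E)); first by [].
  have c0' : 0 <= c%:E by rewrite lee_fin.
  have Ef0 p : setT p -> 0 <= (f p)%:E by rewrite lee_fin.
  have Sf0 y : setT y -> 0 <= \int[m1]_x (f (x, y))%:E by move=> _; exact: sec0.
  rewrite (ge0_integralZl _ measurableT _ Ef0 c0'); last exact/measurable_EFinP.
  rewrite Pf -(ge0_integralZl _ measurableT (msec f mf f0) Sf0 c0').
  apply: eq_integral => y _.
  by rewrite -(ge0_integralZl _ measurableT (m1sec f y mf) (fun x _ => Ef0 (x, y) I) c0').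
- move=> f g mf mg f0 g0 Pf Pg.
  transitivity (\int[prodm]_p ((f p)%:E + (g p)%:E)); first by [].
  have E0 (h : T1 * T2 -> R) : (forall p, (0 <= h p)%R) ->
      forall p, setT p -> 0 <= (h p)%:E.
    by move=> h0 p _; rewrite lee_fin.
  have S0 (h : T1 * T2 -> R) : (forall p, (0 <= h p)%R) ->
      forall y, setT y -> 0 <= \int[m1]_x (h (x, y))%:E.
    by move=> h0 y _; exact: sec0.
  have mE (h : T1 * T2 -> R) : measurable_fun setT h -> measurable_fun setT (EFin \o h).
    by move=> mh; exact/measurable_EFinP.
  rewrite (ge0_integralD _ measurableT (E0 f f0) (mE f mf) (E0 g g0) (mE g mg)).
  rewrite Pf Pg -(ge0_integralD _ measurableT (S0 f f0) (msec f mf f0)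
    (S0 g g0) (msec g mg g0)).
  apply: eq_integral => y _.
  by rewrite -(ge0_integralD _ measurableT (fun x _ => E0 f f0 (x, y) I) (m1sec f y mf)
    (fun x _ => E0 g g0 (x, y) I) (m1sec g y mg)).
- move=> f_ f mf_ f_0 f_nd f_f mf Pf_.
  have cE (p : T1 * T2) : (f p)%:E = limn (fun n => (f_ n p)%:E).
    by apply/esym/cvg_lim => //; apply: cvg_EFin; [exact: nearW|exact: f_f].
  transitivity (\int[prodm]_p limn (fun n => (f_ n p)%:E)).
    by apply: eq_integral => p _; exact: cE.
  rewrite monotone_convergence//; [|by move=> n; exact/measurable_EFinP
    |by move=> n p _; rewrite lee_fin|by move=> p _ m n mn; rewrite lee_fin f_nd].
  have ->: (fun n => \int[prodm]_x (f_ n x)%:E) =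
      fun n => \int[m2]_y \int[m1]_x (f_ n (x, y))%:E by apply/funext.
  rewrite -monotone_convergence//; [|by move=> n; exact: msec
    |by move=> n y _; exact: sec0|]; last first.
    move=> y _ m n mn; apply: ge0_le_integral => //; try exact: m1sec.
      by move=> x _; rewrite lee_fin.
    by move=> x _; rewrite lee_fin f_nd.
  apply: eq_integral => y _.
  transitivity (\int[m1]_x limn (fun n => (f_ n (x, y))%:E)); last first.
    by apply: eq_integral => x _; rewrite cE.
  rewrite monotone_convergence//; [by move=> n; exact: m1sec
    |by move=> n p _; rewrite lee_fin|by move=> p _ m n mn; rewrite lee_fin f_nd].
Qed.

End product.

(** * Density of rectangles *)

Section L2_real_parts.
Context d (T : measurableType d) (R : realType).
Variable mu : {measure set T -> \bar R}.
Local Notation N := (L2sqnorm mu).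
Local Notation realc u := (fun x => real_complex R (u x)).

Definition cind (A : set T) : T -> R[i] := realc (\1_A : T -> R).

Lemma L2_le (f g : T -> R[i]) : cmeasurable f ->
  (forall x, sqc (f x) <= sqc (g x)) -> L2 mu g -> L2 mu f.
Proof.
move=> mf fg [mg g2]; split => //; apply: le_lt_trans g2; rewrite !L2sqnormE.
apply: ge0_le_integral => //.
- by move=> x _; rewrite lee_fin sqc_ge0.
- exact: measurable_sqcE.
- exact: measurable_sqcE.
- by move=> x _; rewrite lee_fin.
Qed.

Lemma cmeasurable_cind A : measurable A -> cmeasurable (cind A).
Proof. by move=> mA; apply: cmeasurable_real; exact: measurable_indic. Qed.

Lemma L2sqnorm_cind A : measurable A -> N (cind A) = mu A.
Proof.
move=> mA; rewrite L2sqnormE -[in RHS](setIT A) -integral_indic//.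
apply: eq_integral => x _; rewrite sqc_real indicE.
by case: (_ \in _); rewrite ?expr1n ?expr0n.
Qed.

Lemma L2_cind A : measurable A -> (mu A < +oo)%E -> L2 mu (cind A).
Proof.
by move=> mA Aoo; split; [exact: cmeasurable_cind|rewrite L2sqnorm_cind].
Qed.

(** Dominated convergence: [0 <= f_ n <= f] bounds the squared distance [(f - f_ n) ^+ 2] by the
    integrable [f ^+ 2]. *)
Lemma L2_dominated_approx (f_ : nat -> T -> R) (f : T -> R) :
  (forall n, measurable_fun setT (f_ n)) -> L2 mu (realc f) ->
  (forall n x, 0 <= f_ n x <= f x) -> (forall x, f_^~ x @ \oo --> f x) ->
  forall e, 0 < e -> exists n, (N (lin (-1) (realc (f_ n)) (realc f)) <= e%:E)%E.
Proof.
move=> mf_ Lf f_f cf e e0.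
have : N (lin (-1) (realc (f_ n)) (realc f)) @[n --> \oo] --> 0%E.
  have -> : 0%E = (\int[mu]_x (cst 0%E) x)%E by rewrite integral0.
  under eq_fun do rewrite L2sqnormE.
  apply: (@dominated_cvg _ _ _ mu setT measurableT _ _
    (fun x => (sqc (real_complex R (f x)))%:E)) => //.
  - move=> n; apply: measurable_sqcE; apply: cmeasurable_lin; last by case: Lf.
    exact: cmeasurable_real.
  - move=> x _; apply: cvg_EFin; first exact: nearW.
    rewrite (_ : _ \o _ = fun n => (f x - f_ n x) ^+ 2); last first.
      apply/funext => n /=; rewrite /lin -(sqc_real (f x - f_ n x)); congr sqc.
      by rewrite mulN1r addrC -rmorphB.
    have -> : 0 = (f x - f x) ^+ 2 :> R by rewrite subrr expr0n.
    rewrite expr2; under eq_fun do rewrite expr2.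
    by apply: cvgM; apply: cvgB => //; exact: cvg_cst.
  - exact: integrable_sqc.
  - move=> n x _; rewrite gee0_abs ?lee_fin ?sqc_ge0//.
    rewrite /lin mulN1r addrC -rmorphB !sqc_real.
    by have /andP[] := f_f n x => ? ?; rewrite ler_sqr ?nnegrE; lra.
move=> /(_ _ (open_ereal_lt' (_ : 0 < e%:E)%E)); rewrite lte_fin => /(_ e0)[n _].
by move=> /(_ n (leqnn n)) /ltW; exists n.
Qed.

End L2_real_parts.

Section nondecreasing_indicators.
Context (T : Type) (R : realType).

Lemma indic_le_bigcup (F : nat -> set T) n x :
  (\1_(F n) x : R) <= \1_(\bigcup_k F k) x.
Proof.
rewrite !indicE ler_nat; have [xn|] := boolP (x \in F n) => //.
by rewrite mem_set//; exists n => //; exact/set_mem.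
Qed.

Lemma cvg_indic_bigcup (F : nat -> set T) x : nondecreasing_seq F ->
  (fun n => \1_(F n) x : R) @ \oo --> (\1_(\bigcup_k F k) x : R).
Proof.
move=> ndF; apply: cvg_near_cst.
have [xF|xF] := boolP (x \in \bigcup_k F k).
  have [m _ xm] := set_mem xF; exists m => // n /= mn.
  rewrite !indicE xF mem_set//.
  by move: x {xF} xm; exact/subsetPset/ndF.
apply: nearW => n; rewrite !indicE (negbTE xF).
rewrite memNset// => xn; move/negP: xF; apply; apply: mem_set.
by exists n.
Qed.

End nondecreasing_indicators.

Section density.
Context d1 d2 (T1 : measurableType d1) (T2 : measurableType d2) (R : realType).
Variable m1 : {sigma_finite_measure set T1 -> \bar R}.
Variable m2 : {measure set T2 -> \bar R}.
Local Notation m12 := (prodm m1 m2).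
Local Notation N := (L2sqnorm m12).
Local Notation realc u := (fun x => real_complex R (u x)).

Variable D : (T1 * T2 -> R[i]) -> Prop.
Hypothesis D_lin : forall a f g, L2 m12 f -> L2 m12 g -> D f -> D g -> D (lin a f g).
Hypothesis D_closed : forall f, L2 m12 f ->
  (forall e : R, 0 < e -> exists g, [/\ L2 m12 g, D g & (N (lin (-1) g f) <= e%:E)%E]) ->
  D f.
Hypothesis D_rect : forall A B, measurable A -> measurable B ->
  (m1 A < +oo)%E -> (m2 B < +oo)%E -> D (cind R (A `*` B)).

Let D_limit (f_ : nat -> T1 * T2 -> R) (f : T1 * T2 -> R) :
  (forall n, measurable_fun setT (f_ n)) -> L2 m12 (realc f) ->
  (forall n x, 0 <= f_ n x <= f x) -> (forall x, f_^~ x @ \oo --> f x) ->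
  (forall n, D (realc (f_ n))) -> D (realc f).
Proof.
move=> mf_ Lf f_f cf Df; apply: D_closed => // e e0.
have [n fn] := L2_dominated_approx mf_ Lf f_f cf e0.
exists (realc (f_ n)); split => //.
apply: L2_le Lf; first exact: cmeasurable_real.
move=> x; rewrite !sqc_real.
by have /andP[f0 ff] := f_f n x; rewrite ler_sqr// nnegrE (le_trans f0).
Qed.

Let D_ae f g : L2 m12 f -> L2 m12 g -> ceq_ae m12 f g -> D f -> D g.
Proof.
move=> Lf Lg fg Df; apply: D_closed => // e e0; exists f; split => //.
have [mf _] := Lf; have [mg _] := Lg.
by rewrite (L2sqnorm_sub_eq0 _ mf mg).2// lee_fin ltW.
Qed.

Let D_indic_bigcup (F : nat -> set (T1 * T2)) : (forall n, measurable (F n)) ->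
  nondecreasing_seq F -> (m12 (\bigcup_n F n) < +oo)%E ->
  (forall n, D (cind R (F n))) -> D (cind R (\bigcup_n F n)).
Proof.
move=> mF ndF Foo DF.
apply: (D_limit (f_ := fun n => \1_(F n))).
- by move=> n; exact: measurable_indic.
- by apply: L2_cind => //; exact: bigcup_measurable.
- by move=> n x; rewrite indic_le_bigcup andbT.
- by move=> x; exact: cvg_indic_bigcup.
- exact: DF.
Qed.

(** A Dynkin class argument inside one fixed rectangle of finite measure: there all indicators are
    square-integrable, so that proper differences and increasing unions stay in [D]. Rectangles
    generate and are closed under intersection. *)
Let D_indic_sub A B : measurable A -> measurable B ->
  (m1 A < +oo)%E -> (m2 B < +oo)%E ->
  forall E, measurable E -> D (cind R (E `&` (A `*` B))).
Proof.
move=> mA mB Aoo Boo.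
have mAB : measurable (A `*` B) by exact: measurableX.
have ABoo : (m12 (A `*` B) < +oo)%E.
  by rewrite prodmX// lte_mul_pinfty// ge0_fin_numE.
have fin E : measurable E -> (m12 (E `&` (A `*` B)) < +oo)%E.
  move=> mE; apply: le_lt_trans ABoo; apply: le_measure; rewrite ?inE//.
  exact: measurableI.
pose H : set (set (T1 * T2)) :=
  [set E | measurable E /\ D (cind R (E `&` (A `*` B)))].
suff : measurable `<=` H by move=> sub E /sub[].
rewrite measurable_prod_measurableType.
set C := [set A1 `*` A2 | A1 in measurable & A2 in measurable].
have CI : setI_closed C.
  move=> X Y [X1 mX1 [X2 mX2 <-{X}]] [Y1 mY1 [Y2 mY2 <-{Y}]].
  exists (X1 `&` Y1); first exact: measurableI.
  by exists (X2 `&` Y2); [exact: measurableI|rewrite setXI].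
have CH : C `<=` H.
  move=> X [X1 mX1 [X2 mX2 <-{X}]]; split; first exact: measurableX.
  rewrite -setXI; apply: D_rect; try exact: measurableI.
  - by apply: le_lt_trans Aoo; apply: le_measure; rewrite ?inE//; exact: measurableI.
  - by apply: le_lt_trans Boo; apply: le_measure; rewrite ?inE//; exact: measurableI.
apply: (lambda_system_subset CI) => //; split => //.
- by apply: CH; exists setT => //; exists setT => //; rewrite setXTT.
- move=> X Y YX [mX DX] [mY DY]; split; first exact: measurableD.
  have -> : cind R ((X `\` Y) `&` (A `*` B)) =
      lin (-1) (cind R (Y `&` (A `*` B))) (cind R (X `&` (A `*` B))).
    apply/funext => x; rewrite /lin /cind mulN1r addrC -rmorphB; congr (real_complex R _).
    have : (x \in Y) ==> (x \in X) by apply/implyP => /set_mem/YX/mem_set.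
    rewrite !indicE in_setI in_setD !in_setI.
    by case: (x \in Y); case: (x \in X); case: (x \in A `*` B) => //= _;
      rewrite ?subrr ?subr0.
  apply: D_lin => //; apply: L2_cind; try exact: fin; exact: measurableI.
- move=> F ndF HF; split; first by apply: bigcup_measurable => n _; case: (HF n).
  rewrite setI_bigcupl; apply: D_indic_bigcup.
  + by move=> n; apply: measurableI => //; case: (HF n).
  + by move=> m n mn; apply/subsetPset; apply: setSI; exact/subsetPset/ndF.
  + by rewrite -setI_bigcupl; apply: fin; apply: bigcup_measurable => n _; case: (HF n).
  + by move=> n; case: (HF n).
Qed.

Let D_indic E : measurable E -> (m12 E < +oo)%E -> D (cind R E).
Proof.
move=> mE Eoo.
have /sigma_finiteP [A [A_T A_nd A_oo]] := sigma_finiteT m1.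
pose phi y := m1 (ysection E y).
have mphi : measurable_fun setT phi by exact: measurable_fun_ysection.
(* [E] is carried, up to a null set, by the rectangles [A n `*` B n]; by Markov's
   inequality [B n] has finite measure although [m2] need not be sigma-finite. *)
pose B n := [set y | (n.+1%:R^-1%:E <= phi y)%E].
have mB n : measurable (B n).
  by rewrite -[B n]setTI; exact: emeasurable_fun_c_infty.
have Boo n : (m2 (B n) < +oo)%E.
  have := le_integral_abse m2 measurableT mphi (a := n.+1%:R^-1).
  rewrite invr_gt0 ltr0n => /(_ isT).
  rewrite setTI (_ : [set x | _] = B n); last first.
    by apply/seteqP; split => y; rewrite /B /= gee0_abs.
  rewrite (_ : \int[m2]_x `|phi x| = m12 E)%E; last first.
    by apply: eq_integral => y _; rewrite gee0_abs.
  move=> /le_lt_trans /(_ Eoo); rewrite ltNge => BE.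
  rewrite ltNge; apply: contra BE; rewrite leye_eq => /eqP ->.
  by rewrite gt0_muley ?leey// lte_fin invr_gt0 ltr0n.
pose F n := E `&` (A n `*` B n).
have mF n : measurable (F n).
  by apply: measurableI => //; apply: measurableX => //; case: (A_oo n).
have B_nd : nondecreasing_seq B.
  move=> m n mn; apply/subsetPset => y; rewrite /B /=; apply: le_trans.
  by rewrite lee_fin lef_pV2 ?posrE ?ltr0n// ler_nat.
have F_nd : nondecreasing_seq F.
  move=> m n mn; apply/subsetPset; apply: setIS; apply: setSX.
    exact/subsetPset/B_nd.
  exact/subsetPset/A_nd.
have mUF : measurable (\bigcup_n F n) by exact: bigcup_measurable.
have UFE : \bigcup_n F n `<=` E by move=> p [n _ []].
have UFoo : (m12 (\bigcup_n F n) < +oo)%E.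
  by apply: le_lt_trans Eoo; apply: le_measure; rewrite ?inE.
have DUF : D (cind R (\bigcup_n F n)).
  apply: D_indic_bigcup => // n; apply: D_indic_sub => //; by case: (A_oo n).
apply: D_ae DUF; [exact: L2_cind|exact: L2_cind|].
(* A section of measure zero contributes nothing; any other [y] lies in [B n] from some [n] on, and
   then the sets [A n] exhaust the section. *)
have null : m12 (E `\` \bigcup_n F n) = 0%E.
  apply: integral0_eq => y _ /=.
  have mS : measurable (ysection E y) by exact: measurable_ysection.
  have [y0|] := eqVneq (phi y) 0%E.
    apply/eqP; rewrite eq_le measure_ge0 andbT -y0 le_measure ?inE//.
      by apply: measurable_ysection; exact: measurableD.
    by apply: le_ysection => p [].
  move=> y0; have yB : exists n, B n y.
    have : (0 < phi y)%E by rewrite lt0e y0 measure_ge0.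
    rewrite /B /=; case: (phi y) => [r|_|//]; last by exists 0%N; rewrite leey.
    rewrite lte_fin => /ltr_add_invr[n]; rewrite add0r => nr.
    by exists n; rewrite lee_fin ltW.
  rewrite (_ : ysection _ y = set0) ?measure0//.
  apply/seteqP; split => // x /ysectionP[Exy]; apply.
  have [n yn] := yB.
  have : (\bigcup_i A i) x by rewrite -A_T.
  move=> [m _ xm]; exists (maxn m n) => //; split => //; split => /=.
    by move: x xm {Exy}; exact/subsetPset/A_nd/leq_maxl.
  by move: y yn {mS y0 yB Exy}; exact/subsetPset/B_nd/leq_maxr.
exists (E `\` \bigcup_n F n); split => //; first exact: measurableD.
move=> p /=; apply: contra_notP => pE; rewrite /cind !indicE.
have [pU|pU] := boolP (p \in \bigcup_n F n).
  by rewrite (mem_set (UFE _ (set_mem pU))).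
rewrite memNset// => Ep; apply: pE; split => //.
by move=> pU'; rewrite (mem_set pU') in pU.
Qed.

(** Density as an induction principle, climbing from indicators to nonnegative, real and complex
    functions. It serves both to construct fibrewise images and to show that operators agreeing on
    rectangles coincide. *)
Lemma L2_density f : L2 m12 f -> D f.
Proof.
have D_nonneg (u : T1 * T2 -> R) : measurable_fun setT u -> (forall x, 0 <= u x) ->
    L2 m12 (realc u) -> D (realc u).
  move: u; apply: nonneg_measurable_ind.
  - move=> A mA [_]; rewrite L2sqnorm_cind//; exact: D_indic.
  - move=> c u c0 mu u0 Du Lcu.
    (* For [c = 0] the hypothesis tells nothing about the norm of [u], so this case is treated as
       the indicator of the empty set. *)
    have [->|cn0] := eqVneq c 0.
      rewrite (_ : (fun x => _) = cind R set0); last first.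
        by apply/funext => x; rewrite /cind mul0r indic0.
      by apply: D_indic => //; rewrite measure0.
    have Lu : L2 m12 (realc u).
      rewrite (_ : (fun x => _) =
        lin (real_complex R c^-1) (realc (fun x => c * u x)) (fun=> 0)).
        by apply: L2_lin => //; exact: L2_0.
      by apply/funext => x; rewrite /lin addr0 -rmorphM mulKf.
    rewrite (_ : (fun x => _) = lin (real_complex R c) (realc u) (cind R set0)).
      by apply: D_lin; [|apply: L2_cind|exact: Du|apply: D_indic]; rewrite ?measure0.
    by apply/funext => x; rewrite /lin /cind indic0 addr0 -rmorphM.
  - move=> u v mu mv u0 v0 Du Dv Luv.
    have Lu : L2 m12 (realc u).
      apply: L2_le Luv; first exact: cmeasurable_real.
      by move=> x; rewrite !sqc_real ler_sqr ?nnegrE ?addr_ge0// lerDl.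
    have Lv : L2 m12 (realc v).
      apply: L2_le Luv; first exact: cmeasurable_real.
      by move=> x; rewrite !sqc_real ler_sqr ?nnegrE ?addr_ge0// lerDr.
    rewrite (_ : (fun x => _) = lin 1 (realc u) (realc v)); last first.
      by apply/funext => x; rewrite /lin mul1r rmorphD.
    by apply: D_lin => //; [exact: Du|exact: Dv].
  - move=> f_ u mf_ f_0 f_nd f_u mu Df_ Lu.
    have f_le n x : 0 <= f_ n x <= u x.
      rewrite f_0/=; rewrite -(cvg_lim _ (f_u x))//.
      apply: nondecreasing_cvgn_le; first by move=> m k; exact: f_nd.
      by apply/cvg_ex; exists (u x); exact: f_u.
    apply: (D_limit (f_ := f_)) => // n; apply: Df_.
    apply: L2_le Lu; first exact: cmeasurable_real.
    move=> x; rewrite !sqc_real; have /andP[? ?] := f_le n x.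
    by rewrite ler_sqr ?nnegrE ?(le_trans (f_0 n x)).
have D_real (u : T1 * T2 -> R) : measurable_fun setT u -> L2 m12 (realc u) ->
    D (realc u).
  move=> mu Lu.
  have mp := measurable_funrpos mu; have mn := measurable_funrneg mu.
  have Lp : L2 m12 (realc (u^\+)).
    apply: L2_le Lu; first exact: cmeasurable_real.
    move=> x; rewrite !sqc_real /funrpos.
    by have [//|u0] := leP 0 (u x); rewrite expr0n sqr_ge0.
  have Ln : L2 m12 (realc (u^\-)).
    apply: L2_le Lu; first exact: cmeasurable_real.
    move=> x; rewrite !sqc_real /funrneg.
    by have [|u0] := leP 0 (- u x); rewrite ?sqrrN// expr0n sqr_ge0.
  rewrite (_ : (fun x => _) = lin (-1) (realc (u^\-)) (realc (u^\+))); last first.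
    by apply/funext => x; rewrite /lin mulN1r addrC -rmorphB -[in LHS](funrposBneg u).
  by apply: D_lin => //; apply: D_nonneg.
move=> Lf; have [[mr mi] _] := Lf.
have Lr : L2 m12 (realc (fun x => complex.Re (f x))).
  apply: L2_le Lf; first exact: cmeasurable_real.
  by move=> x; rewrite sqc_real /sqc lerDl sqr_ge0.
have Li : L2 m12 (realc (fun x => complex.Im (f x))).
  apply: L2_le Lf; first exact: cmeasurable_real.
  by move=> x; rewrite sqc_real /sqc lerDr sqr_ge0.
rewrite (_ : f = lin 'i%C (realc (fun x => complex.Im (f x)))
    (realc (fun x => complex.Re (f x)))); last first.
  apply/funext => x; rewrite /lin; case: (f x) => a b /=.
  by congr (_ +i* _)%C; ring.
by apply: D_lin => //; apply: D_real.
Qed.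

End density.

(** * Fibrewise action of an isometry *)

Section fast_convergence.
Context d (T : measurableType d) (R : realType).
Variable mu : {measure set T -> \bar R}.
Local Notation N := (L2sqnorm mu).

Lemma summable_cvg0 (a : nat -> R) : (forall n, 0 <= a n) ->
  (\sum_(0 <= k <oo) (a k)%:E < +oo)%E -> a @ \oo --> 0.
Proof.
move=> a0 aoo; apply: cvg_series_cvg_0; apply: nondecreasing_is_cvgn.
  move=> m n mn; rewrite /series /= (@big_cat_nat _ _ _ m 0 n)//= lerDl.
  by rewrite sumr_ge0.
have s0 : (0 <= \sum_(0 <= k <oo) (a k)%:E)%E.
  by apply: nneseries_ge0 => n _ _; rewrite lee_fin.
exists (fine (\sum_(0 <= k <oo) (a k)%:E)) => _ [n _ <-].
rewrite -lee_fin fineK ?ge0_fin_numE// /series /= -sumEFin.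
by apply: nneseries_lim_ge => k _ _; rewrite lee_fin.
Qed.

Lemma sqc_cvg (z : nat -> R[i]) (w : R[i]) :
  (fun k => sqc (-1 * z k + w)) @ \oo --> 0 ->
  (fun k => complex.Re (z k)) @ \oo --> complex.Re w /\
  (fun k => complex.Im (z k)) @ \oo --> complex.Im w.
Proof.
move=> /cvgrPdist_lt zw.
have bound (x : nat -> R) (l : R) : (forall k, (l - x k) ^+ 2 <= sqc (-1 * z k + w)) ->
    x @ \oo --> l.
  move=> xl; apply/cvgrPdist_lt => e e0.
  have := zw (e ^+ 2) (exprn_gt0 _ e0); apply: filterS => k /=.
  rewrite sub0r normrN ger0_norm ?sqc_ge0// => /(le_lt_trans (xl k)).
  by rewrite -real_normK ?num_real// ltr_sqr// nnegrE ?ltW.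
split; apply: bound => k; case: (z k) => a b; case: w {zw} => a' b'; rewrite /sqc /=.
- by rewrite (_ : -1 * a - _ = - a) ?[- a + a']addrC ?lerDl ?sqr_ge0//; ring.
- by rewrite (_ : -1 * b + _ = - b) ?[- b + b']addrC ?lerDr ?sqr_ge0//; ring.
Qed.

(** Exchanging sum and integral shows the pointwise series of squared distances to be finite almost
    everywhere, so its terms tend to 0. Summability replaces the passage to a subsequence. *)
Lemma L2_fast_cvg (h_ : nat -> T -> R[i]) (h : T -> R[i]) :
  (forall k, cmeasurable (h_ k)) -> cmeasurable h ->
  (\sum_(0 <= k <oo) N (lin (-1) (h_ k) h) < +oo)%E ->
  {ae mu, forall x,
    (fun k => complex.Re (h_ k x)) @ \oo --> complex.Re (h x) /\
    (fun k => complex.Im (h_ k x)) @ \oo --> complex.Im (h x)}.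
Proof.
move=> mh_ mh.
have ml k : measurable_fun setT (fun x => (sqc (lin (-1) (h_ k) h x))%:E).
  by apply: measurable_sqcE; exact: cmeasurable_lin.
under eq_eseriesr do rewrite L2sqnormE.
rewrite -integral_nneseries//; last by move=> n x _; rewrite lee_fin sqc_ge0.
move=> Soo.
have S0 x : (0 <= \sum_(0 <= k <oo) (sqc (lin (-1) (h_ k) h x))%:E)%E.
  by apply: nneseries_ge0 => n _ _; rewrite lee_fin sqc_ge0.
have : mu.-integrable setT
    (fun x => \sum_(0 <= k <oo) (sqc (lin (-1) (h_ k) h x))%:E)%E.
  apply/integrableP; split.
    apply: ge0_emeasurable_sum => // k x _ _; by rewrite lee_fin sqc_ge0.
  by under eq_integral do rewrite gee0_abs//.
move=> /(integrable_ae measurableT); apply: filterS => x /(_ I).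
rewrite ge0_fin_numE// => xoo; apply: sqc_cvg.
by apply: summable_cvg0 xoo => k; exact: sqc_ge0.
Qed.

End fast_convergence.

Section complex_limsup.
Context d (T : measurableType d) (R : realType).

(* The junk value at an infinite limsup is harmless: only values at convergent
   sequences matter below. *)
Definition rlimsup (u : nat -> R) : R := fine (limn_esup (EFin \o u)).

Lemma cvg_rlimsup (u : nat -> R) l : u @ \oo --> l -> rlimsup u = l.
Proof.
move=> ul; rewrite /rlimsup.
have ul' : EFin \o u @ \oo --> l%:E by apply: cvg_EFin => //; exact: nearW.
rewrite is_cvg_limn_esupE; last by apply/cvg_ex; exists l%:E.
by rewrite (cvg_lim _ ul').
Qed.

Lemma measurable_rlimsup (u : nat -> T -> R) :
  (forall n, measurable_fun setT (u n)) ->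
  measurable_fun setT (fun x => rlimsup (u^~ x)).
Proof.
move=> mu; apply: (measurableT_comp (f := fine)) => //.
apply: (measurable_fun_limn_esup (f := fun n => EFin \o u n)) => n.
exact/measurable_EFinP.
Qed.

(** A candidate for the pointwise limit that is defined everywhere and measurable whether or not the
    sequence converges. *)
Definition climsup (h_ : nat -> T -> R[i]) : T -> R[i] := fun x =>
  (rlimsup (fun k => complex.Re (h_ k x)) +i* rlimsup (fun k => complex.Im (h_ k x)))%C.

Lemma cmeasurable_climsup h_ : (forall k, cmeasurable (h_ k)) ->
  cmeasurable (climsup h_).
Proof. by move=> mh; split; apply: measurable_rlimsup => k; case: (mh k). Qed.

End complex_limsup.

(** * Linear operators, norms and scalar products *)

Section L2_isometry.
Context d1 d2 (T1 : measurableType d1) (T2 : measurableType d2) (R : realType).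
Variables (mu1 : {measure set T1 -> \bar R}) (mu2 : {measure set T2 -> \bar R}).
Variable U : (T1 -> R[i]) -> (T2 -> R[i]).
Hypothesis U_linear : L2_linear mu1 mu2 U.

Lemma L2_linear_L2 f : L2 mu1 f -> L2 mu2 (U f).
Proof. by case: U_linear => h _ _; exact: h. Qed.

Lemma L2_linear_lin a f g : L2 mu1 f -> L2 mu1 g ->
  ceq_ae mu2 (U (lin a f g)) (lin a (U f) (U g)).
Proof. by case: U_linear => _ _; exact. Qed.

Lemma L2_linear_lin_norm a f g : L2 mu1 f -> L2 mu1 g ->
  L2sqnorm mu2 (lin a (U f) (U g)) = L2sqnorm mu2 (U (lin a f g)).
Proof.
move=> Lf Lg; apply: L2sqnorm_ae; last first.
- by apply: filterS (L2_linear_lin a Lf Lg) => x ->.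
- by case: (L2_linear_L2 (L2_lin a Lf Lg)).
- by apply: cmeasurable_lin; [case: (L2_linear_L2 Lf)|case: (L2_linear_L2 Lg)].
Qed.

Lemma L2_linear_scale a f : L2 mu1 f ->
  ceq_ae mu2 (U (fun x => a * f x)) (fun x => a * U f x).
Proof.
move=> Lf; have L0 := L2_0 mu1.
(* [L2_linear] speaks of combinations [a * f + g] only; with [a = 1] and both functions null it
   gives [U 0 = U 0 + U 0] almost everywhere. *)
have U0 : ceq_ae mu2 (U (fun=> 0)) (fun=> 0).
  apply: filterS (L2_linear_lin 1 L0 L0) => y; rewrite /lin.
  rewrite (_ : (fun=> _) = fun=> 0); last by apply/funext => x; rewrite mulr0 addr0.
  by move/eqP; rewrite mul1r -subr_eq0 opprD addrA subrr add0r oppr_eq0 => /eqP.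
have := L2_linear_lin a Lf L0.
rewrite (_ : lin a f (fun=> 0) = fun x => a * f x); last first.
  by apply/funext => x; rewrite /lin addr0.
by move=> Uf; apply: filterS2 Uf U0 => y ->; rewrite /lin => ->; rewrite addr0.
Qed.

Lemma L2_norm_preserving_dot :
  (forall f, L2 mu1 f -> L2sqnorm mu2 (U f) = L2sqnorm mu1 f) ->
  forall f g, L2 mu1 f -> L2 mu1 g -> L2dot mu2 (U f) (U g) = L2dot mu1 f g.
Proof.
move=> U_norm f g Lf Lg.
rewrite !L2dot_polar//; try exact: L2_linear_L2.
by rewrite !L2_linear_lin_norm// !U_norm//; exact: L2_lin.
Qed.

Lemma L2_dot_preserving_norm :
  (forall f, L2 mu1 f -> L2dot mu2 (U f) (U f) = L2dot mu1 f f) ->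
  forall f, L2 mu1 f -> L2sqnorm mu2 (U f) = L2sqnorm mu1 f.
Proof.
have dotE d (T : measurableType d) (mu : {measure set T -> \bar R}) (f : T -> R[i]) :
    complex.Re (L2dot mu f f) = fine (L2sqnorm mu f).
  rewrite /= L2sqnormE; congr fine; apply: eq_integral => x _; congr EFin.
  by case: (f x) => a b; rewrite /sqc /=; ring.
move=> U_dot f Lf.
rewrite -(fineK (L2_fin_num (L2_linear_L2 Lf))) -(fineK (L2_fin_num Lf)).
by rewrite -!dotE U_dot.
Qed.

End L2_isometry.

Section fibrewise.
Context d1 d2 (T1 : measurableType d1) (T2 : measurableType d2) (R : realType).
Variable m1 : {sigma_finite_measure set T1 -> \bar R}.
Variable m2 : {measure set T2 -> \bar R}.
Local Notation m12 := (prodm m1 m2).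
Local Notation N12 := (L2sqnorm m12).
Local Notation N1 := (L2sqnorm m1).
Implicit Types F G H K : T1 * T2 -> R[i].

Definition sec F (y : T2) : T1 -> R[i] := fun x => F (x, y).

Lemma cmeasurable_sec F y : cmeasurable F -> cmeasurable (sec F y).
Proof.
move=> [mr mi]; split.
- exact: (measurableT_comp mr (pair2_measurable y)).
- exact: (measurableT_comp mi (pair2_measurable y)).
Qed.

Lemma L2sqnorm_prodm F : cmeasurable F ->
  N12 F = (\int[m2]_y N1 (sec F y))%E.
Proof.
move=> mF; rewrite L2sqnormE tonelli_prodm.
- by apply: eq_integral => y _; rewrite L2sqnormE.
- exact: measurable_sqc.
- by move=> p; exact: sqc_ge0.
Qed.

Lemma measurable_L2sqnorm_sec F : cmeasurable F ->
  measurable_fun setT (fun y => N1 (sec F y)).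
Proof.
move=> mF.
rewrite (_ : (fun y => _) = fun y => (\int[m1]_x (sqc (F (x, y)))%:E)%E).
  apply: (measurable_integral_ysection m1 (f := EFin \o (fun p => sqc (F p)))).
    exact: measurable_sqcE.
  by move=> p; rewrite lee_fin sqc_ge0.
by apply/funext => y; rewrite L2sqnormE.
Qed.

Lemma L2_sec F : L2 m12 F -> {ae m2, forall y, L2 m1 (sec F y)}.
Proof.
move=> [mF]; rewrite L2sqnorm_prodm// => Foo.
have : m2.-integrable setT (fun y => N1 (sec F y)).
  apply/integrableP; split; first exact: measurable_L2sqnorm_sec.
  by under eq_integral do rewrite gee0_abs ?L2sqnorm_ge0//.
move=> /(integrable_ae measurableT); apply: filterS => y /(_ I).
rewrite ge0_fin_numE ?L2sqnorm_ge0// => yoo; split => //.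
exact: cmeasurable_sec.
Qed.

Lemma cindX (A : set T1) (B : set T2) :
  cind R (A `*` B) = fun p => cind R A p.1 * cind R B p.2.
Proof.
apply/funext => -[x y]; rewrite /cind -rmorphM; congr (real_complex R _).
by rewrite !indicE in_setX /=; do 2 case: (_ \in _); rewrite /= ?mulr1 ?mulr0.
Qed.

Lemma cmeasurable_tensor (f : T1 -> R[i]) (g : T2 -> R[i]) :
  cmeasurable f -> cmeasurable g ->
  cmeasurable (fun p : T1 * T2 => f p.1 * g p.2).
Proof.
move=> [fr fi] [gr gi].
have c1 (u : T1 -> R) : measurable_fun setT u ->
    measurable_fun setT (fun p : T1 * T2 => u p.1).
  by move=> mu; exact: (measurableT_comp mu measurable_fst).
have c2 (u : T2 -> R) : measurable_fun setT u ->
    measurable_fun setT (fun p : T1 * T2 => u p.2).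
  by move=> mu; exact: (measurableT_comp mu measurable_snd).
split.
- rewrite (_ : (fun _ => _) = fun p => complex.Re (f p.1) * complex.Re (g p.2) -
      complex.Im (f p.1) * complex.Im (g p.2)); last first.
    by apply/funext => p; case: (f _) => ? ?; case: (g _).
  apply: measurable_funB; apply: measurable_funM;
    [exact: (c1 _ fr)|exact: (c2 _ gr)|exact: (c1 _ fi)|exact: (c2 _ gi)].
- rewrite (_ : (fun _ => _) = fun p => complex.Re (f p.1) * complex.Im (g p.2) +
      complex.Im (f p.1) * complex.Re (g p.2)); last first.
    by apply/funext => p; case: (f _) => ? ?; case: (g _).
  apply: measurable_funD; apply: measurable_funM;
    [exact: (c1 _ fr)|exact: (c2 _ gi)|exact: (c1 _ fi)|exact: (c2 _ gr)].
Qed.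

Lemma L2_tensor (f : T1 -> R[i]) (g : T2 -> R[i]) : L2 m1 f -> L2 m2 g ->
  L2 m12 (fun p => f p.1 * g p.2).
Proof.
move=> Lf Lg; have [mf _] := Lf; have [mg _] := Lg.
have mfg := cmeasurable_tensor mf mg; split => //.
rewrite (L2sqnorm_prodm mfg).
rewrite (_ : (\int[m2]_y _)%E = (N1 f * L2sqnorm m2 g)%E).
  by rewrite lte_mul_pinfty ?L2sqnorm_ge0// ?L2_fin_num//; case: Lg.
rewrite (L2sqnormE m2) -ge0_integralZl//; first last.
- exact: L2sqnorm_ge0.
- by move=> y _; rewrite lee_fin sqc_ge0.
- exact: measurable_sqcE.
apply: eq_integral => y _; rewrite muleC -L2sqnormZ//; congr (L2sqnorm m1 _).
by apply/funext => x; rewrite /sec mulrC.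
Qed.

Variable U : (T1 -> R[i]) -> (T1 -> R[i]).
Hypothesis U_linear : L2_linear m1 m1 U.
Hypothesis U_norm : forall f, L2 m1 f -> N1 (U f) = N1 f.

(** A relation and not a function of [F]: each [U (sec F y)] is meaningful only up to a null set
    depending on [y], so applying [U] section by section need not give a jointly measurable
    function. Sections outside L^2 are excluded because [U] is arbitrary there. *)
Definition fibrewise F H : Prop := cmeasurable H /\
  {ae m2, forall y, L2 m1 (sec F y) -> ceq_ae m1 (sec H y) (U (sec F y))}.

Lemma fibrewise_norm F H : L2 m12 F -> fibrewise F H -> N12 H = N12 F.
Proof.
move=> LF [mH FH]; have [mF _] := LF.
rewrite (L2sqnorm_prodm mH) (L2sqnorm_prodm mF).
apply: ge0_ae_eq_integral => //; try exact: measurable_L2sqnorm_sec.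
- by move=> y _; exact: L2sqnorm_ge0.
- by move=> y _; exact: L2sqnorm_ge0.
apply: filterS2 (L2_sec LF) FH => y Ly /(_ Ly) FHy _.
rewrite -(U_norm Ly); apply: L2sqnorm_ae => //; first exact: cmeasurable_sec.
by case: (L2_linear_L2 U_linear Ly).
Qed.

Lemma fibrewise_L2 F H : L2 m12 F -> fibrewise F H -> L2 m12 H.
Proof.
move=> LF FH; split; first by case: FH.
by rewrite (fibrewise_norm LF FH); case: LF.
Qed.

Lemma fibrewise_lin a F G H K : L2 m12 F -> L2 m12 G ->
  fibrewise F H -> fibrewise G K -> fibrewise (lin a F G) (lin a H K).
Proof.
move=> LF LG [mH FH] [mK GK]; split; first exact: cmeasurable_lin.
have FH' : {ae m2, forall y, L2 m1 (sec F y) /\ ceq_ae m1 (sec H y) (U (sec F y))}.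
  by apply: filterS2 (L2_sec LF) FH => y Ly /(_ Ly).
have GK' : {ae m2, forall y, L2 m1 (sec G y) /\ ceq_ae m1 (sec K y) (U (sec G y))}.
  by apply: filterS2 (L2_sec LG) GK => y Ly /(_ Ly).
apply: filterS2 FH' GK' => y [LFy FHy] [LGy GKy] _.
have HK : {ae m1, forall x,
    lin a (sec H y) (sec K y) x = lin a (U (sec F y)) (U (sec G y)) x}.
  by apply: filterS2 FHy GKy => x; rewrite /lin => -> ->.
by apply: filterS2 HK (L2_linear_lin U_linear a LFy LGy) => x + ->.
Qed.

(** [lin (-1) H K] is a fibrewise image of [lin (-1) F G], whose norm is 0. With [F = G] this is
    uniqueness of the fibrewise image. *)
Lemma fibrewise_ae F G H K : L2 m12 F -> L2 m12 G -> ceq_ae m12 F G ->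
  fibrewise F H -> fibrewise G K -> ceq_ae m12 H K.
Proof.
move=> LF LG FG FH GK.
apply/L2sqnorm_sub_eq0; [by case: FH|by case: GK|].
rewrite (fibrewise_norm (L2_lin _ LF LG) (fibrewise_lin (-1) LF LG FH GK)).
by apply/L2sqnorm_sub_eq0 => //; [case: LF|case: LG].
Qed.

(** Each section is a scalar multiple of [f], so the relation is the homogeneity of [U], valid at
    every [y]. *)
Lemma fibrewise_tensor (f : T1 -> R[i]) (g : T2 -> R[i]) :
  L2 m1 f -> cmeasurable g ->
  fibrewise (fun p => f p.1 * g p.2) (fun p => U f p.1 * g p.2).
Proof.
move=> Lf mg; split.
  by apply: cmeasurable_tensor => //; case: (L2_linear_L2 U_linear Lf).
apply: aeW => y _; apply: filterS (L2_linear_scale U_linear (g y) Lf) => x.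
rewrite /sec /= mulrC => <-; congr (U _ _).
by apply/funext => z; rewrite mulrC.
Qed.

(* For almost every [y] the squared distances of the sections are summable, so the
   sections of [H_ k] converge pointwise a.e. to [U (sec F y)]: the limit is known
   beforehand and completeness of L^2 is not needed. *)
Lemma fibrewise_limit F (G_ H_ : nat -> T1 * T2 -> R[i]) : L2 m12 F ->
  (forall k, L2 m12 (G_ k)) -> (forall k, fibrewise (G_ k) (H_ k)) ->
  (\sum_(0 <= k <oo) N12 (lin (-1) (G_ k) F) < +oo)%E ->
  fibrewise F (climsup H_).
Proof.
move=> LF LG GH Soo; have [mF _] := LF.
have mG k : cmeasurable (G_ k) by case: (LG k).
have mH k : cmeasurable (H_ k) by case: (GH k).
split; first exact: cmeasurable_climsup.
have ml k : cmeasurable (lin (-1) (G_ k) F) by exact: cmeasurable_lin.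
have S_ae : {ae m2, forall y,
    (\sum_(0 <= k <oo) N1 (lin (-1) (sec (G_ k) y) (sec F y)) < +oo)%E}.
  have S0 y : (0 <= \sum_(0 <= k <oo) N1 (lin (-1) (sec (G_ k) y) (sec F y)))%E.
    by apply: nneseries_ge0 => k _ _; exact: L2sqnorm_ge0.
  have : m2.-integrable setT
      (fun y => \sum_(0 <= k <oo) N1 (lin (-1) (sec (G_ k) y) (sec F y)))%E.
    apply/integrableP; split.
      apply: ge0_emeasurable_sum => [k y _ _|k _]; first exact: L2sqnorm_ge0.
      exact: (measurable_L2sqnorm_sec (ml k)).
    under eq_integral do rewrite gee0_abs//.
    rewrite integral_nneseries//.
    - rewrite (eq_eseriesr (g := fun k => N12 (lin (-1) (G_ k) F)))// => k _.
      by rewrite L2sqnorm_prodm.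
    - by move=> k; exact: (measurable_L2sqnorm_sec (ml k)).
    - by move=> k y _; exact: L2sqnorm_ge0.
  move=> /(integrable_ae measurableT); apply: filterS => y /(_ I).
  by rewrite ge0_fin_numE.
have G_ae : {ae m2, forall y k, L2 m1 (sec (G_ k) y) /\
    ceq_ae m1 (sec (H_ k) y) (U (sec (G_ k) y))}.
  apply: ae_foralln => k.
  by apply: filterS2 (L2_sec (LG k)) (GH k).2 => y Ly /(_ Ly).
apply: filterS2 S_ae G_ae => y Sy Gy LFy.
have LUF := L2_linear_L2 U_linear LFy.
have /L2_fast_cvg : (\sum_(0 <= k <oo)
    N1 (lin (-1) (sec (H_ k) y) (U (sec F y))) < +oo)%E.
  rewrite (eq_eseriesr (g := fun k => N1 (lin (-1) (sec (G_ k) y) (sec F y))))//.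
  move=> k _; have [LGy GHy] := Gy k.
  rewrite -(U_norm (L2_lin (-1) LGy LFy)).
  rewrite -(L2_linear_lin_norm U_linear)//; apply: L2sqnorm_ae.
  - by apply: cmeasurable_lin; [exact: cmeasurable_sec|case: LUF].
  - by apply: cmeasurable_lin; [case: (L2_linear_L2 U_linear LGy)|case: LUF].
  - by apply: filterS GHy => x; rewrite /lin => ->.
move=> /(_ (fun k => cmeasurable_sec y (mH k)) LUF.1).
apply: filterS => x [rx ix]; rewrite /sec /climsup /=.
rewrite (cvg_rlimsup rx) (cvg_rlimsup ix).
by case: (U _ _).
Qed.

Lemma fibrewise_exists F : L2 m12 F -> exists H, fibrewise F H.
Proof.
move: F; apply: L2_density.
- move=> a F G LF LG [H FH] [K GK]; exists (lin a H K); exact: fibrewise_lin.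
- move=> F LF FD.
  (* Squared distances at most [1 / 2 ^ k.+1] make the series required by [fibrewise_limit]
     converge. *)
  have /choice [GH GHP] : forall k : nat,
      exists GH : (T1 * T2 -> R[i]) * (T1 * T2 -> R[i]),
      [/\ L2 m12 GH.1, fibrewise GH.1 GH.2 &
       (N12 (lin (-1) GH.1 F) <= (1 / (2 ^ k.+1)%:R)%:E)%E].
    move=> k; have [|G [LG [H GH] FG]] := FD (1 / (2 ^ k.+1)%:R).
      by rewrite divr_gt0// ltr0n expn_gt0.
    by exists (G, H).
  exists (climsup (fun k => (GH k).2)).
  apply: (@fibrewise_limit F (fun k => (GH k).1)) => //.
  - by move=> k; case: (GHP k).
  - by move=> k; case: (GHP k).
  - apply: (@le_lt_trans _ _ (\sum_(0 <= k <oo) (1 / (2 ^ k.+1)%:R)%:E)%E).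
      apply: lee_nneseries => [k _ _|k _]; first exact: L2sqnorm_ge0.
      by case: (GHP k).
    by apply: le_lt_trans (epsilon_trick0 xpredT ler01) _; rewrite ltry.
- move=> A B mA mB Aoo Boo.
  exists (fun p => U (cind R A) p.1 * cind R B p.2).
  rewrite cindX.
  apply: fibrewise_tensor; [exact: L2_cind|exact: cmeasurable_cind].
Qed.

End fibrewise.

(** * Unitarity of [tensor_id] *)

Section bounded_operators.
Context d1 d2 (T1 : measurableType d1) (T2 : measurableType d2) (R : realType).
Variables (mu1 : {measure set T1 -> \bar R}) (mu2 : {measure set T2 -> \bar R}).
Implicit Types U V : (T1 -> R[i]) -> (T2 -> R[i]).

Lemma L2sqnorm_subC d (T : measurableType d) (mu : {measure set T -> \bar R})
    (f g : T -> R[i]) : L2sqnorm mu (lin (-1) f g) = L2sqnorm mu (lin (-1) g f).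
Proof.
rewrite !L2sqnormE; apply: eq_integral => x _; rewrite /lin.
by case: (f x) => a b; case: (g x) => a' b'; rewrite /sqc /=; congr EFin; ring.
Qed.

(** The operators agree at a nearby [g], so [V f - U f] is almost everywhere
    [U (g - f) + V (f - g)], which boundedness makes small. *)
Lemma L2_bounded_linear_closed U V f :
  L2_bounded_linear mu1 mu2 U -> L2_bounded_linear mu1 mu2 V -> L2 mu1 f ->
  (forall e : R, 0 < e -> exists g, [/\ L2 mu1 g, ceq_ae mu2 (U g) (V g) &
    (L2sqnorm mu1 (lin (-1) g f) <= e%:E)%E]) ->
  ceq_ae mu2 (U f) (V f).
Proof.
move=> [Ulin [CU Ub]] [Vlin [CV Vb]] Lf approx.
have LUf := L2_linear_L2 Ulin Lf; have LVf := L2_linear_L2 Vlin Lf.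
have [mUf _] := LUf; have [mVf _] := LVf.
apply/(L2sqnorm_sub_eq0 _ mUf mVf).
have Nfin := L2_fin_num (L2_lin (-1) LUf LVf).
rewrite -(fineK Nfin); congr EFin.
set x := fine _; have x0 : 0 <= x by rewrite fine_ge0// L2sqnorm_ge0.
(* [CU] and [CV] may be negative, hence the absolute values; the added 1 makes [C] positive even
   when both vanish. *)
pose C := `|CU| + `|CV| + 1.
have C0 : 0 < C by rewrite ltr_wpDl// addr_ge0.
apply/eqP; rewrite eq_le x0 andbT; apply/ler_addgt0Pr => e e0; rewrite add0r.
(* The factor 2 compensates the constant in [L2sqnorm_lin]. *)
have [g [Lg UVg fg]] := approx (e / (2 * C)) (divr_gt0 e0 (mulr_gt0 (ltr0n _ 2) C0)).
have LUg := L2_linear_L2 Ulin Lg; have LVg := L2_linear_L2 Vlin Lg.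
have [mUg _] := LUg; have [mVg _] := LVg.
have -> : e = 2 * (C * (e / (2 * C))) by field; rewrite gt_eqF.
rewrite -lee_fin (fineK Nfin).
rewrite (@L2sqnorm_ae _ _ _ _ _ (lin 1 (lin (-1) (U f) (U g)) (lin (-1) (V g) (V f)))).
- apply: (le_trans (L2sqnorm_lin _ _ _ _)); try exact: cmeasurable_lin.
  rewrite (_ : sqc 1 = 1) ?mul1e; last by rewrite /sqc /= expr0n expr1n addr0.
  rewrite [leRHS]EFinM; apply: lee_wpmul2l; first by rewrite lee_fin.
  have Lgf := L2_lin (-1) Lg Lf; have Lfg := L2_lin (-1) Lf Lg.
  rewrite (L2_linear_lin_norm Ulin)// (L2_linear_lin_norm Vlin)//.
  apply: (le_trans (leeD (Ub _ Lfg) (Vb _ Lgf))).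
  rewrite L2sqnorm_subC -(fineK (L2_fin_num Lgf)).
  have r0 : 0 <= fine (L2sqnorm mu1 (lin (-1) g f)) by rewrite fine_ge0// L2sqnorm_ge0.
  move: fg; rewrite -{1}(fineK (L2_fin_num Lgf)) lee_fin => fg.
  rewrite -!EFinM -EFinD lee_fin -mulrDl.
  apply: (@le_trans _ _ (C * fine (L2sqnorm mu1 (lin (-1) g f)))); last first.
    by rewrite ler_pM2l.
  apply: ler_wpM2r => //; rewrite /C.
  by have := ler_norm CU; have := ler_norm CV; lra.
- exact: cmeasurable_lin.
- by apply: cmeasurable_lin; exact: cmeasurable_lin.
- by apply: filterS UVg => y; rewrite /lin => ->; ring.
Qed.

Lemma L2_linear_ceq_ae_lin U V a f g :
  L2_linear mu1 mu2 U -> L2_linear mu1 mu2 V -> L2 mu1 f -> L2 mu1 g ->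
  ceq_ae mu2 (U f) (V f) -> ceq_ae mu2 (U g) (V g) ->
  ceq_ae mu2 (U (lin a f g)) (V (lin a f g)).
Proof.
move=> Ulin Vlin Lf Lg UVf UVg.
have UV : {ae mu2, forall y, lin a (U f) (U g) y = lin a (V f) (V g) y}.
  by apply: filterS2 UVf UVg => y; rewrite /lin => -> ->.
by apply: filterS3 (L2_linear_lin Ulin a Lf Lg) (L2_linear_lin Vlin a Lf Lg) UV =>
  y -> -> ->.
Qed.

End bounded_operators.

Section L2_unitary_inverse.
Context d (T : measurableType d) (R : realType).
Variable mu : {measure set T -> \bar R}.
Variable U : (T -> R[i]) -> (T -> R[i]).
Hypothesis U_unitary : L2_unitary mu mu U.
Local Notation N := (L2sqnorm mu).

Lemma L2_unitary_linear : L2_linear mu mu U.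
Proof. by case: U_unitary. Qed.

Lemma L2_unitary_norm f : L2 mu f -> N (U f) = N f.
Proof.
apply: L2_dot_preserving_norm; first exact: L2_unitary_linear.
by move=> g Lg; case: U_unitary => _ ->.
Qed.

Lemma L2_unitary_inj f g : L2 mu f -> L2 mu g -> ceq_ae mu (U f) (U g) ->
  ceq_ae mu f g.
Proof.
move=> Lf Lg UfUg; have [mf _] := Lf; have [mg _] := Lg.
have [mUf _] := L2_linear_L2 L2_unitary_linear Lf.
have [mUg _] := L2_linear_L2 L2_unitary_linear Lg.
apply/(L2sqnorm_sub_eq0 _ mf mg); rewrite -(L2_unitary_norm (L2_lin (-1) Lf Lg)).
rewrite -(L2_linear_lin_norm L2_unitary_linear)//.
exact/(L2sqnorm_sub_eq0 _ mUf mUg).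
Qed.

(** The inverse picks an arbitrary preimage of each function. Injectivity of [U], a consequence of
    isometry, makes these choices linear and compatible with almost everywhere equality. *)
Lemma L2_unitary_inverse : exists W : (T -> R[i]) -> (T -> R[i]),
  [/\ L2_linear mu mu W, forall h, L2 mu h -> N (W h) = N h &
   forall h, L2 mu h -> ceq_ae mu (U (W h)) h].
Proof.
have [_ _ Usurj] := U_unitary.
have Ulin := L2_unitary_linear; have [_ Uae _] := Ulin.
have /choice [W WP] : forall h, exists f, L2 mu h -> L2 mu f /\ ceq_ae mu (U f) h.
  move=> h; have [/Usurj[f Lf Ufh]|nLh] := pselect (L2 mu h); first by exists f.
  by exists h.
have LW h : L2 mu h -> L2 mu (W h) by move=> /WP[].
have UW h : L2 mu h -> ceq_ae mu (U (W h)) h by move=> /WP[].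
exists W; split => //.
- split => //.
  + move=> h k Lh Lk hk; apply: L2_unitary_inj; [exact: LW|exact: LW|].
    by apply: filterS3 (UW h Lh) (UW k Lk) hk => x -> ->.
  + move=> a h k Lh Lk; rewrite -/(lin a h k).
    have Lhk := L2_lin a Lh Lk; have LWhk := L2_lin a (LW h Lh) (LW k Lk).
    apply: L2_unitary_inj => //; first exact: LW.
    have hk : {ae mu, forall x, lin a (U (W h)) (U (W k)) x = lin a h k x}.
      by apply: filterS2 (UW h Lh) (UW k Lk) => x; rewrite /lin => -> ->.
    by apply: filterS3 (UW _ Lhk) (L2_linear_lin Ulin a (LW h Lh) (LW k Lk)) hk =>
      x -> -> ->.
- move=> h Lh; rewrite -(L2_unitary_norm (LW h Lh)).
  apply: L2sqnorm_ae; [|by case: Lh|exact: UW].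
  by case: (L2_linear_L2 Ulin (LW h Lh)).
Qed.

End L2_unitary_inverse.

Section tensor_id.
Variables (R : realType) (Xi : normedModType R) (Sigma : ptopologicalType).
Variable mu : {sigma_finite_measure set (borel Xi) -> \bar R}.
Variable nu : {measure set (borel Sigma) -> \bar R}.
Variable U : (Xi -> R[i]) -> (Xi -> R[i]).
Hypothesis U_unitary : L2_unitary mu mu U.
Local Notation munu := (prod_measure mu nu).
Local Notation N := (L2sqnorm munu).

Let Ulin : L2_linear mu mu U := L2_unitary_linear U_unitary.
Let Unorm f : L2 mu f -> L2sqnorm mu (U f) = L2sqnorm mu f :=
  @L2_unitary_norm _ _ _ _ _ U_unitary f.

(** Linearity and the value on simple tensors follow from uniqueness of fibrewise images; the bound
    holds with constant 1. *)
Let fibrewise_is_tensor_id V :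
  (forall F, L2 munu F -> fibrewise mu nu U F (V F)) -> is_tensor_id mu nu U V.
Proof.
move=> VP; split; first split; first split.
- by move=> F LF; exact: (fibrewise_L2 Ulin Unorm LF (VP F LF)).
- by move=> F G LF LG FG; exact: (fibrewise_ae Ulin Unorm LF LG FG (VP F LF) (VP G LG)).
- move=> a F G LF LG; have LFG := L2_lin a LF LG.
  have FG := fibrewise_lin Ulin a LF LG (VP F LF) (VP G LG).
  exact: (fibrewise_ae Ulin Unorm LFG LFG (aeW _ _) (VP _ LFG) FG).
- by exists 1 => F LF; rewrite mul1e (fibrewise_norm Ulin Unorm LF (VP F LF)).
- move=> f g Lf Lg; have Lfg := L2_tensor Lf Lg.
  apply: (fibrewise_ae Ulin Unorm Lfg Lfg (aeW _ _) (VP _ Lfg)) => //.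
  by apply: fibrewise_tensor => //; case: Lg.
Qed.

(** Boundedness makes the set of agreement closed, and it contains the rectangles, whose indicators
    are simple tensors. *)
Let is_tensor_id_unique V W : is_tensor_id mu nu U V -> is_tensor_id mu nu U W ->
  forall F, L2 munu F -> ceq_ae munu (V F) (W F).
Proof.
move=> [Vbl Vt] [Wbl Wt]; apply: L2_density.
- by move=> a F G; exact: (L2_linear_ceq_ae_lin a Vbl.1 Wbl.1).
- by move=> F LF; exact: L2_bounded_linear_closed.
- move=> A B mA mB Aoo Boo.
  rewrite cindX.
  have LA := L2_cind mA Aoo; have LB := L2_cind mB Boo.
  by apply: filterS2 (Vt _ _ LA LB) (Wt _ _ LA LB) => p -> ->.
Qed.

Lemma tensor_id_unitary : [/\ L2_linear munu munu (tensor_id mu nu U),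
  forall F, L2 munu F -> N (tensor_id mu nu U F) = N F &
  forall H, L2 munu H -> exists2 F, L2 munu F & ceq_ae munu (tensor_id mu nu U F) H].
Proof.
have /choice [V VP] : forall F, exists H, L2 munu F -> fibrewise mu nu U F H.
  move=> F; have [LF|nLF] := pselect (L2 munu F); last by exists F.
  by have [H FH] := fibrewise_exists Ulin Unorm LF; exists H.
have Vt : is_tensor_id mu nu U V by exact: fibrewise_is_tensor_id.
(* [V] shows that a tensor operator exists, so [xget] returns one and not the default 0; uniqueness
   then identifies it with [V] almost everywhere. *)
have tid : is_tensor_id mu nu U (tensor_id mu nu U).
  by apply: (@xgetPex _ _ [set V | is_tensor_id mu nu U V]); exists V.
have tidV := is_tensor_id_unique tid Vt.
have tlin : L2_linear munu munu (tensor_id mu nu U) by case: tid => -[].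
split => //.
- move=> F LF; rewrite -(fibrewise_norm Ulin Unorm LF (VP F LF)).
  apply: L2sqnorm_ae; last exact: tidV.
    by case: (L2_linear_L2 tlin LF).
  by case: (VP F LF).
- move=> H LH.
  have [W [Wlin Wnorm UW]] := L2_unitary_inverse U_unitary.
  have [F HF] := fibrewise_exists Wlin Wnorm LH.
  have LF := fibrewise_L2 Wlin Wnorm LH HF.
  exists F => //.
  (* [F] comes from [H] by the inverse [W]; as [U] undoes [W] on almost every section, [H] is in
     turn a fibrewise image of [F] under [U]. *)
  have FH : fibrewise mu nu U F H.
    split; first by case: LH.
    have [_ Uae _] := Ulin.
    apply: filterS2 (L2_sec LH) HF.2 => y LHy /(_ LHy) HFy LFy.
    apply: filterS2 (UW _ LHy) (Uae _ _ LFy (L2_linear_L2 Wlin LHy) HFy) => x.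
    by move=> <- ->.
  have VFH := fibrewise_ae Ulin Unorm LF LF (aeW _ (fun=> erefl)) (VP F LF) FH.
  by apply: filterS2 (tidV F LF) VFH => p ->.
Qed.

End tensor_id.

(** * Borel sets of the product *)

Section finite_dimension.
Variables (R : realType) (Xi : normedModType R) (m : nat).

Lemma linear_rV_sum (e : {linear 'rV[R]_m -> Xi}) v :
  e v = \sum_(j < m) v 0 j *: e (delta_mx 0 j).
Proof.
by rewrite {1}[v]row_sum_delta linear_sum; apply: eq_bigr => j _; rewrite linearZ.
Qed.

Lemma linear_rV_continuous (e : {linear 'rV[R]_m -> Xi}) : continuous e.
Proof.
rewrite (_ : (e : 'rV[R]_m -> Xi) =
    fun v => \sum_(j < m) v 0 j *: e (delta_mx 0 j)); last first.
  by apply/funext => v; exact: linear_rV_sum.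
apply: continuous_big; first exact: add_continuous.
move=> j _ v; exact: (cvgZr_tmp (@coord_continuous R 1 m 0 j v)).
Qed.

Hypothesis hdim : has_dimension Xi m.

(** Linear images of the cubes [[-n, n]^m], compact because a linear map out of ['rV[R]_m] is
    continuous. *)
Lemma has_dimension_compact_cover : exists A : nat -> set Xi,
  [/\ forall n, compact (A n), nondecreasing_seq A & \bigcup_n A n = setT].
Proof.
have [e [g eK gK]] := hdim.
pose box n := [set v : 'rV[R]_m | forall i, `[(- n%:R : R), n%:R]%classic (v ord0 i)].
exists (fun n => e @` box n); split.
- move=> n; apply: continuous_compact.
    by apply: continuous_subspaceT; exact: linear_rV_continuous.
  apply: (@rV_compact R m (fun=> `[(- n%:R : R), n%:R]%classic)) => i.
  exact: segment_compact.
- move=> k n kn; apply/subsetPset; apply: image_subset => v vk i.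
  have := vk i; rewrite /= !in_itv /= => /andP[v1 v2].
  have kn' : k%:R <= n%:R :> R by rewrite ler_nat.
  by rewrite (le_trans _ v1) ?lerN2// (le_trans v2).
- apply/seteqP; split => // x _; pose v := g x.
  (* The sum of absolute values dominates every coordinate, and the successor of its truncation
     exceeds it. *)
  pose n := (Num.truncn (\sum_(i < m) `|v ord0 i|)).+1.
  exists n => //; exists v; last exact: gK.
  move=> i; rewrite /= in_itv /= -ler_norml.
  apply: (le_trans _ (ltW (truncnS_gt _))).
  by rewrite (bigD1 i)//= lerDl sumr_ge0.
Qed.

(** The images of rational row vectors, enumerated by their codes; a number that is no code is sent
    to the default 0. *)
Lemma has_dimension_dense : exists q : nat -> Xi,
  forall x e, 0 < e -> exists n, ball (q n) e x.
Proof.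
have [e [g eK gK]] := hdim.
exists (fun n => if (choice.unpickle n : option 'rV[rat]_m) is Some r
  then e (map_mx ratr r) else 0) => x d d0.
pose v := g x; pose c := \sum_(j < m) `|e (delta_mx 0 j)|.
have c0 : 0 <= c by rewrite sumr_ge0.
(* Dividing by [c + 1] keeps [t] positive when [c = 0] and makes [t * c < d] strict. *)
pose t := d / (c + 1).
have t0 : 0 < t by rewrite divr_gt0// ltr_wpDl.
have /choice [r rP] : forall j, exists r : rat, `|ratr r - v 0 j| < t.
  move=> j; have [|r] := @rat_in_itvoo _ (v 0 j - t) (v 0 j + t).
    by rewrite ltrBlDr -addrA ltrDl addr_gt0.
  by rewrite in_itv /= => rt; exists r; rewrite ltr_distl.
exists (choice.pickle (\row_j r j)); rewrite choice.pickleK -(gK x) -/v.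
rewrite -ball_normE /= -linearB linear_rV_sum.
apply: (le_lt_trans (ler_norm_sum _ _ _)).
apply: (@le_lt_trans _ _ (t * c)).
  rewrite mulr_sumr; apply: ler_sum => j _; rewrite normrZ ler_wpM2r//.
  by rewrite !mxE ltW.
by rewrite /t mulrAC ltr_pdivrMr ?ltr_wpDl// ltr_pM2l// ltrDl.
Qed.

End finite_dimension.

Section borel_product.
Variables (R : realType) (Xi : normedModType R) (Sigma : ptopologicalType).
Variable q : nat -> Xi.
Hypothesis q_dense : forall x e, 0 < e -> exists n, ball (q n) e x.

Lemma open_borel (T : ptopologicalType) (A : set T) :
  open A -> measurable (A : set (borel T)).
Proof. by move=> oA; exact: sub_sigma_algebra. Qed.

Lemma closed_borel (T : ptopologicalType) (A : set T) :
  closed A -> measurable (A : set (borel T)).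
Proof.
move=> cA; rewrite -(setCK A); apply: measurableC; apply: open_borel.
exact: closed_openC.
Qed.

(** [W] is a union of rectangles indexed by the balls with centre [q n] and radius [1 / (k + 1)],
    which are countably many; countability is drawn from [Xi] alone. *)
Lemma open_prod_measurable (W : set (Xi * Sigma)) : open W ->
  measurable (W : set (borel Xi * borel Sigma)%type).
Proof.
move=> oW.
pose B n k := ball (q n) (k.+1%:R^-1 : R).
(* The union over all open sets admissible for the ball may be uncountable, but it is open, hence
   Borel. *)
pose V n k := \bigcup_(V in [set V : set Sigma | open V /\ B n k `*` V `<=` W]) V.
have -> : W = \bigcup_n \bigcup_k (B n k `*` V n k).
  apply/seteqP; split => [[x s] Wxs|[x s] [n _ [k _ [Bx [V' [_ sub] Vs]]]]]; last first.
    by apply: sub; split.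
  have : nbhs (x, s) W by apply: open_nbhs_nbhs.
  move=> [[/= A V'] [xA sV'] AVW].
  move/nbhs_ballP : xA => [e /= e0 eA].
  (* With a radius below [e / 2], a ball containing [x] lies in the ball of radius [e] around
     [x]. *)
  have [k] := ltr_add_invr (divr_gt0 e0 (ltr0n R 2)); rewrite add0r => ke.
  have k0 : 0 < k.+1%:R^-1 :> R by rewrite invr_gt0.
  have [n xn] := q_dense x k0.
  exists n => //; exists k => //; split => //.
  move: sV'; rewrite nbhsE => -[V0 [oV0 sV0] V0V'].
  exists V0 => //; split => // -[y z] [/= By V0z]; apply: AVW; split; last exact: V0V'.
  apply: eA; apply: (@le_ball _ _ _ (k.+1%:R^-1 + k.+1%:R^-1)).
    by rewrite [leRHS]splitr lerD// ltW.
  by apply: ball_triangle By; exact: ball_sym.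
apply: bigcup_measurable => n _; apply: bigcup_measurable => k _.
apply: measurableX; apply: open_borel; first exact: ball_open.
by apply: bigcup_open => U [].
Qed.

Lemma continuous_prod_measurable (f : Xi * Sigma -> Sigma) : continuous f ->
  @measurable_fun _ _ (borel Xi * borel Sigma)%type (borel Sigma) setT f.
Proof.
move=> cf; apply: (@measurability _ _ (borel Xi * borel Sigma)%type (borel Sigma) setT f
  (@open Sigma)) => // _ [U oU <-].
by rewrite setTI; apply: open_prod_measurable; move/continuousP : cf; exact.
Qed.

End borel_product.

(** * Invariance of the product measure under the action *)

Lemma measure_bigcup_le d (T : measurableType d) (R : realType)
    (m : {measure set T -> \bar R}) (F : nat -> set T) c :
  (forall n, measurable (F n)) -> nondecreasing_seq F ->
  (forall n, (m (F n) <= c)%E) -> (m (\bigcup_n F n) <= c)%E.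
Proof.
move=> mF ndF Fc.
apply: (cvge_to_le (nondecreasing_cvg_mu mF (bigcup_measurable _) ndF)) => //.
exact: nearW.
Qed.

(** * Sigma-compact sets carrying an integral *)

Section inner_regularity.
Variables (R : realType) (Sigma : ptopologicalType).
Hypothesis Sigma_hausdorff : hausdorff_space Sigma.
Variable nu : {measure set (borel Sigma) -> \bar R}.
Hypothesis nu_radon : is_radon nu.
Local Open Scope ereal_scope.

Lemma compact_borel (T : ptopologicalType) (K : set T) : hausdorff_space T ->
  compact K -> measurable (K : set (borel T)).
Proof. by move=> hT cK; apply: closed_borel; exact: compact_closed. Qed.

Let sigma_compact (S : set (borel Sigma)) :=
  exists K : nat -> set Sigma, (forall n, compact (K n)) /\ S = \bigcup_n K n.

Let sigma_compact_measurable S : sigma_compact S -> measurable S.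
Proof.
by move=> [K [cK ->]]; apply: bigcup_measurable => n _; exact: compact_borel.
Qed.

Let sigma_compactU S S' : sigma_compact S -> sigma_compact S' -> sigma_compact (S `|` S').
Proof.
move=> [K [cK ->]] [K' [cK' ->]]; exists (fun n => K n `|` K' n); split.
  by move=> n; exact: compactU.
by rewrite bigcupU.
Qed.

(** The double sequence of compact sets is enumerated through codes of pairs, with the empty set at
    numbers that are no code. *)
Let sigma_compact_bigcup (S : nat -> set (borel Sigma)) :
  (forall n, sigma_compact (S n)) -> sigma_compact (\bigcup_n S n).
Proof.
move=> /choice[K KP].
exists (fun n => if (choice.unpickle n : option (nat * nat)) is Some (i, j)
  then K i j else set0); split.
  move=> n; case: (choice.unpickle n) => [[i j]|]; last exact: compact0.
  by case: (KP i).
apply/seteqP; split => s.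
  move=> [i _]; have [_ ->] := KP i; move=> [j _ sK].
  by exists (choice.pickle (i, j)) => //; rewrite choice.pickleK.
move=> [n _]; case: (choice.unpickle n) => [[i j]|//] sK.
by exists i => //; have [_ ->] := KP i; exists j.
Qed.

(** An equality of possibly infinite integrals; in this form the property passes to sums and
    monotone limits. *)
Let carried (f : borel Sigma -> R) := exists2 S, sigma_compact S &
  \int[nu]_(s in S) (f s)%:E = \int[nu]_s (f s)%:E.

Let carried_le (f : borel Sigma -> R) S S' : measurable_fun setT f ->
  (forall s, (0 <= f s)%R) -> sigma_compact S -> sigma_compact S' -> S `<=` S' ->
  \int[nu]_(s in S) (f s)%:E = \int[nu]_s (f s)%:E ->
  \int[nu]_(s in S') (f s)%:E = \int[nu]_s (f s)%:E.
Proof.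
move=> mf f0 /sigma_compact_measurable mS /sigma_compact_measurable mS' SS' Sf.
have mE D : measurable_fun D (fun s => (f s)%:E).
  by apply: measurable_funTS; exact/measurable_EFinP.
apply/eqP; rewrite eq_le; apply/andP; split.
  by apply: ge0_subset_integral => // s _; rewrite lee_fin.
by rewrite -Sf; apply: ge0_subset_integral => // s _; rewrite lee_fin.
Qed.

(** For an indicator, inner regularity supplies compact sets whose measures approach that of the
    set, and their union carries it. Carriers may be enlarged, so their unions serve for sums and
    monotone limits. Integrals are thereby reduced to sets exhausted by finite measure even if [nu]
    is not sigma-finite. *)
Lemma radon_integral_sigma_compact (f : borel Sigma -> R) :
  measurable_fun setT f -> (forall s, (0 <= f s)%R) ->
  exists2 K : nat -> set Sigma, (forall n, compact (K n)) &
    \int[nu]_(s in \bigcup_n K n) (f s)%:E = \int[nu]_s (f s)%:E.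
Proof.
suff H : forall f : borel Sigma -> R, measurable_fun setT f ->
    (forall s, (0 <= f s)%R) -> carried f.
  by move=> mf f0; have [S [K [cK ->]] KE] := H f mf f0; exists K.
clear f.
have mE (g : borel Sigma -> R) D : measurable_fun setT g ->
    measurable_fun D (fun s => (g s)%:E).
  by move=> mg; apply: measurable_funTS; exact/measurable_EFinP.
apply: nonneg_measurable_ind.
- move=> B mB.
  have approx (t : nat -> R) : (forall n, (t n)%:E < nu B) ->
      exists S, [/\ sigma_compact S, S `<=` B & forall n, (t n)%:E < nu S].
    move=> tB; have /choice[K KP] : forall n, exists K : set Sigma,
        [/\ compact K, K `<=` B & (t n)%:E < nu K].
      move=> n; have := tB n; rewrite nu_radon.2// => /ereal_sup_gt[_ [K [cK KB] <-]] tK.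
      by exists K.
    have scK : sigma_compact (\bigcup_n K n) by exists K; split => // n; case: (KP n).
    exists (\bigcup_n K n); split => //.
      by apply: bigcup_sub => n _; case: (KP n).
    move=> n; have [cK _ tK] := KP n; apply: (lt_le_trans tK).
    apply: le_measure; rewrite ?inE; first exact: compact_borel.
      exact: sigma_compact_measurable.
    exact: bigcup_sup.
  have nuS S : sigma_compact S -> S `<=` B -> nu B <= nu S -> carried \1_B.
    move=> scS SB BS; have mS := sigma_compact_measurable scS.
    exists S => //; rewrite !integral_indic// setIT setIC.
    rewrite (setIidl SB); apply/eqP; rewrite eq_le BS andbT.
    by apply: le_measure; rewrite ?inE.
  have B0 : 0 <= nu B by exact: measure_ge0.
  (* The thresholds tend to [nu B]: they are [r - 1 / (n + 1)] for a finite measure [r], and the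
     natural numbers for an infinite one. *)
  case BE : (nu B) => [r| |].
  + have [|S [scS SB tS]] := approx (fun n => r - n.+1%:R^-1)%R.
      by move=> n; rewrite BE lte_fin ltrBlDr ltrDl invr_gt0.
    apply: (nuS S) => //; rewrite BE.
    have S0 : 0 <= nu S by exact: measure_ge0.
    case SE : (nu S) => [s| |]; [|by rewrite leey|by rewrite SE in S0].
    rewrite leNgt; apply/negP; rewrite lte_fin => /ltr_add_invr[n sr].
    have := tS n; rewrite SE lte_fin.
    by rewrite ltrBlDr ltNge (ltW sr).
  + have [|S [scS SB tS]] := approx (fun n => n%:R)%R.
      by move=> n; rewrite BE ltry.
    apply: (nuS S) => //; rewrite BE.
    have S0 : 0 <= nu S by exact: measure_ge0.
    case SE : (nu S) => [s| |]; [|by []|by rewrite SE in S0].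
    have := tS (Num.truncn s).+1; rewrite SE lte_fin.
    by rewrite ltNge (ltW (truncnS_gt _)).
  + by rewrite BE in B0.
- move=> c f c0 mf f0 [S scS SE]; exists S => //.
  have mS := sigma_compact_measurable scS.
  have E D : measurable D -> \int[nu]_(s in D) (c * f s)%:E =
      c%:E * \int[nu]_(s in D) (f s)%:E.
    move=> mD; rewrite -ge0_integralZl//; [exact: mE|].
    by move=> s _; rewrite lee_fin.
  by rewrite !E// SE.
- move=> f g mf mg f0 g0 [S scS Sf] [S' scS' Sg]; exists (S `|` S').
    exact: sigma_compactU.
  have scU := sigma_compactU scS scS'; have mU := sigma_compact_measurable scU.
  have E D : measurable D -> \int[nu]_(s in D) (f s + g s)%:E =
      \int[nu]_(s in D) (f s)%:E + \int[nu]_(s in D) (g s)%:E.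
    move=> mD; rewrite -ge0_integralD//; try exact: mE;
      by move=> s _; rewrite lee_fin.
  rewrite !E//; congr (_ + _).
    exact: (carried_le mf f0 scS scU (@subsetUl _ _ _) Sf).
  exact: (carried_le mg g0 scS' scU (@subsetUr _ _ _) Sg).
- move=> f_ f mf_ f_0 f_nd f_f mf cf_.
  have /choice[S SP] : forall n, exists S, sigma_compact S /\
      \int[nu]_(s in S) (f_ n s)%:E = \int[nu]_s (f_ n s)%:E.
    by move=> n; have [S] := cf_ n; exists S.
  have scU : sigma_compact (\bigcup_n S n).
    by apply: sigma_compact_bigcup => n; case: (SP n).
  exists (\bigcup_n S n) => //.
  have mU := sigma_compact_measurable scU.
  have E D : measurable D -> \int[nu]_(s in D) (f s)%:E =
      limn (fun n => \int[nu]_(s in D) (f_ n s)%:E).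
    move=> mD; rewrite -monotone_convergence//.
    + apply: eq_integral => s _; apply/esym/cvg_lim => //.
      by apply: cvg_EFin; [exact: nearW|exact: f_f].
    + by move=> n; exact: mE.
    + by move=> n s _; rewrite lee_fin.
    + by move=> s _ m n mn; rewrite lee_fin f_nd.
  rewrite !E//; congr (limn _); apply/funext => n; have [scSn Sn] := SP n.
  apply: (carried_le (mf_ n) (f_0 n) scSn scU _ Sn).
  exact: bigcup_sup.
Qed.

End inner_regularity.

Section product_restriction.
Context d1 d2 (T1 : measurableType d1) (T2 : measurableType d2) (R : realType).
Variable m1 : {sigma_finite_measure set T1 -> \bar R}.
Variable m2 : {measure set T2 -> \bar R}.
Local Open Scope ereal_scope.

Lemma prodm_setI_snd (X : set (T1 * T2)) (D : set T2) : measurable X -> measurable D ->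
  prodm m1 m2 (X `&` (setT `*` D)) = \int[m2]_(y in D) m1 (ysection X y).
Proof.
move=> mX mD; rewrite [RHS]integral_mkcond; apply: eq_integral => y _.
rewrite patchE /= ysectionI; case: ifPn => yD.
  by rewrite in_ysectionX// setIT.
by rewrite notin_ysectionX// setI0 measure0.
Qed.

(** Restricted to [D] the measure [m2] is finite, so the product measure is there determined by its
    values on rectangles and may be computed in the other order. *)
Lemma prodm_setI_snd_fin (X : set (T1 * T2)) (D : set T2) : measurable X ->
  measurable D -> m2 D < +oo ->
  prodm m1 m2 (X `&` (setT `*` D)) = \int[m1]_x m2 (xsection X x `&` D).
Proof.
move=> mX mD Doo.
have mTD : measurable ([set: T1] `*` D) by exact: measurableX.
have -> : \int[m1]_x m2 (xsection X x `&` D) = (m1 \x mfrestr mD Doo) X by [].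
rewrite (@product_measure_unique _ _ _ _ _ m1 (mfrestr mD Doo)
  (mrestr (prodm m1 m2) mTD))// => A B mA mB.
rewrite /mfrestr /= /mrestr -setXI setIT prodmX//.
exact: measurableI.
Qed.

End product_restriction.

(** * The shear of the product by the action *)

Section shear.
Variables (R : realType) (Xi : normedModType R) (Sigma : ptopologicalType).
Variable m : nat.
Hypothesis hdim : has_dimension Xi m.
Hypothesis Sigma_hausdorff : hausdorff_space Sigma.
Variable mu : {sigma_finite_measure set (borel Xi) -> \bar R}.
Hypothesis mu_compact : forall K : set Xi, compact K -> (mu K < +oo)%E.
Variable nu : {measure set (borel Sigma) -> \bar R}.
Hypothesis nu_radon : is_radon nu.
Local Notation munu := (prodm mu nu).
Local Notation XS := (borel Xi * borel Sigma)%type.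
Implicit Type Theta : Xi -> Sigma -> Sigma.

(** The point map behind the change of variables: [action_change Theta F] is [F \o shear Theta]. *)
Definition shear Theta (p : XS) : XS := (p.1, Theta p.1 p.2).

Lemma measurable_shear Theta : continuous (fun p : Xi * Sigma => Theta p.1 p.2) ->
  measurable_fun setT (shear Theta).
Proof.
move=> cT; have [q q_dense] := has_dimension_dense hdim.
apply: (measurable_fun_pair (f := fst) (g := fun p : XS => Theta p.1 p.2 : borel Sigma)).
  exact: measurable_fst.
exact: (continuous_prod_measurable q_dense cT).
Qed.

Section invariant.
Variable Theta : Xi -> Sigma -> Sigma.
Hypothesis cTheta : continuous (fun p : Xi * Sigma => Theta p.1 p.2).
Hypothesis iTheta : is_invariant Theta nu.

Local Open Scope ereal_scope.

Let measurable_preshear (E : set XS) : measurable E ->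
  measurable (shear Theta @^-1` E).
Proof.
by move=> mE; rewrite -[_ @^-1` _]setTI; exact: (measurable_shear cTheta).
Qed.

(* The shear maps [A `*` K] into [A `*` L] with [L] compact; as [nu K] and [nu L] are
   finite, Tonelli's theorem lets us integrate over [Sigma] first, where [nu] is
   invariant. *)
Let shear_le_compact (E : set XS) (A : set Xi) (K : set Sigma) :
  measurable E -> compact A -> compact K ->
  munu (shear Theta @^-1` E `&` A `*` K) <= munu E.
Proof.
move=> mE cA cK.
pose L := (fun p : Xi * Sigma => Theta p.1 p.2) @` (A `*` K).
have cL : compact L.
  apply: continuous_compact; last exact: compact_setX.
  exact: continuous_subspaceT.
have mA : measurable (A : set (borel Xi)).
  by apply: compact_borel cA; exact: norm_hausdorff.
have mK : measurable (K : set (borel Sigma)) by exact: compact_borel.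
have mL : measurable (L : set (borel Sigma)) by exact: compact_borel.
have mG := measurable_preshear mE.
have mAT : measurable (A `*` setT : set XS) by exact: measurableX.
have mGA : measurable (shear Theta @^-1` E `&` A `*` setT) by exact: measurableI.
rewrite (_ : _ `&` _ `*` _ =
    (shear Theta @^-1` E `&` A `*` setT) `&` (setT `*` K)); last first.
  by rewrite -setIA -setXI setIT setTI.
rewrite prodm_setI_snd_fin//; last exact: nu_radon.1.
have mTL : measurable (setT `*` L : set XS) by exact: measurableX.
apply: (@le_trans _ _ (munu (E `&` (setT `*` L)))); last first.
  by apply: le_measure; rewrite ?inE//; exact: measurableI.
rewrite prodm_setI_snd_fin//; last exact: nu_radon.1.
have mfin (X : set XS) (D : set (borel Sigma)) : measurable X -> measurable D ->
    nu D < +oo -> measurable_fun setT (fun x => nu (xsection X x `&` D)).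
  by move=> mX mD Doo; exact: (measurable_fun_xsection (mfrestr mD Doo) mX).
apply: ge0_le_integral => //.
- by apply: mfin => //; exact: nu_radon.1.
- by apply: mfin => //; exact: nu_radon.1.
move=> x _.
have mS : measurable (xsection E x `&` L : set (borel Sigma)).
  by apply: measurableI => //; exact: measurable_xsection.
have [xA|xA] := pselect (A x); last first.
  rewrite (_ : _ `&` K = set0) ?measure0//.
  by apply/seteqP; split => // y [/xsectionP[_ [/xA]]].
(* Invariance replaces the section of [E] within [L] by its preimage under [Theta x], which contains
   the section of the preimage within [K] because [Theta x] maps [K] into [L]. *)
rewrite -(iTheta x mS); apply: le_measure; rewrite ?inE.
- by apply: measurableI => //; exact: measurable_xsection.
- rewrite -[_ @^-1` _]setTI.
  have [q q_dense] := has_dimension_dense hdim.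
  have mT := continuous_prod_measurable q_dense cTheta.
  exact: (measurableT_comp mT (pair1_measurable x)).
- move=> y [/xsectionP[Exy _] Ky]; split; first by apply/xsectionP.
  by exists (x, y).
Qed.

(** Two exhaustions lead to the compact case: [Xi] by the compact sets [A n], then [Sigma] by
    compact sets carrying the measure of the sections of the preimage. *)
Lemma shear_le (E : set XS) : measurable E -> munu (shear Theta @^-1` E) <= munu E.
Proof.
move=> mE; set G := shear Theta @^-1` E.
have mG : measurable G by exact: measurable_preshear.
have [A [cA ndA A_T]] := has_dimension_compact_cover hdim.
have mA n : measurable (A n : set (borel Xi)).
  by apply: compact_borel (cA n); exact: norm_hausdorff.
have mAX n (D : set (borel Sigma)) : measurable D -> measurable (A n `*` D : set XS).
  by move=> mD; exact: measurableX.
have -> : G = \bigcup_n (G `&` (A n `*` setT)).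
  by rewrite -setI_bigcupr -setX_bigcupl A_T setXTT setIT.
apply: measure_bigcup_le.
- by move=> n; apply: measurableI => //; exact: mAX.
- move=> k n kn; apply/subsetPset; apply: setIS; apply: setSX => //.
  exact/subsetPset/ndA.
move=> n; set X := G `&` _.
have mX : measurable X by apply: measurableI => //; exact: mAX.
(* Over the compact [A n] sections have finite measure, so [phi] can be made real-valued as
   [radon_integral_sigma_compact] demands. *)
pose phi y := mu (ysection X y).
have phi_fin y : phi y \is a fin_num.
  rewrite ge0_fin_numE ?measure_ge0//; apply: le_lt_trans (mu_compact (cA n)).
  apply: le_measure; rewrite ?inE//; first exact: measurable_ysection.
  by move=> x /ysectionP[_ []].
have phiE y : (fine (phi y))%:E = phi y by exact: fineK.
have [|s|K cK KE] := @radon_integral_sigma_compact _ _ Sigma_hausdorff _ nu_radon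
  (fun y => fine (phi y)).
- apply: (measurableT_comp (f := fine)) => //; exact: measurable_fun_ysection.
- exact: fine_ge0.
have mK k : measurable (K k : set (borel Sigma)) by exact: compact_borel.
(* Finite unions remain compact and make the exhaustion increasing. *)
pose K' k := \big[setU/set0]_(i < k.+1) K i.
have cK' k : compact (K' k) by apply: bigsetU_compact => i _; exact: cK.
have UK' : \bigcup_k K' k = \bigcup_k K k.
  exact: bigcup_bigsetU_bigcup.
(* Cutting [X] down to the part above the carrier leaves its measure unchanged. *)
have -> : munu X = munu (\bigcup_k (X `&` (setT `*` K' k))).
  rewrite -setI_bigcupr -setX_bigcupr UK' prodm_setI_snd//; last exact: bigcup_measurable.
  under eq_integral do rewrite -/(phi _) -phiE.
  rewrite KE; apply: eq_integral => y _; exact/esym/phiE.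
apply: measure_bigcup_le.
- move=> k; apply: measurableI => //; apply: measurableX => //.
  exact: compact_borel.
- move=> j k jk; apply/subsetPset; apply: setIS; apply: setSX => //.
  exact: subset_bigsetU.
move=> k; rewrite /X -setIA -setXI setIT setTI.
exact: shear_le_compact.
Qed.

End invariant.

Variable Theta : Xi -> Sigma -> Sigma.
Hypothesis hTheta : is_continuous_action Theta.
Hypothesis iTheta : is_invariant Theta nu.

Local Notation Theta' := (fun X => Theta (- X)).

Lemma shearK : cancel (shear Theta) (shear Theta').
Proof.
move=> [x s]; have [T0 TD _] := hTheta.
by rewrite /shear /= -TD addNr T0.
Qed.

Lemma shear'K : cancel (shear Theta') (shear Theta).
Proof.
move=> [x s]; have [T0 TD _] := hTheta.
by rewrite /shear /= -TD subrr T0.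
Qed.

Let cTheta : continuous (fun p : Xi * Sigma => Theta p.1 p.2).
Proof. by case: hTheta. Qed.

Lemma continuous_opp_action : continuous (fun p : Xi * Sigma => Theta (- p.1) p.2).
Proof.
move=> [x s].
apply: (@continuous_comp _ _ _ (fun p : Xi * Sigma => (- p.1, p.2))
  (fun p : Xi * Sigma => Theta p.1 p.2)); last exact: cTheta.
apply: cvg_pair; last exact: cvg_snd.
by apply: cvgN; exact: cvg_fst.
Qed.

Lemma invariant_opp_action : is_invariant Theta' nu.
Proof. by move=> X A mA; exact: iTheta. Qed.

(** The reverse inequality is [shear_le] for [X |-> Theta (- X)], applied to the preimage of [E]:
    the two shears are mutually inverse. *)
Lemma shear_invariant (E : set XS) : measurable E ->
  munu (shear Theta @^-1` E) = munu E.
Proof.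
move=> mE; apply/eqP; rewrite eq_le shear_le//=.
have mG : measurable (shear Theta @^-1` E).
  by rewrite -[_ @^-1` _]setTI; exact: (measurable_shear cTheta).
have := shear_le continuous_opp_action invariant_opp_action mG.
rewrite -comp_preimage (_ : shear Theta \o shear Theta' = id)//.
by apply/funext => p; exact: shear'K.
Qed.

Lemma cmeasurable_shear (F : XS -> R[i]) : cmeasurable F ->
  cmeasurable (F \o shear Theta).
Proof.
have mT := measurable_shear cTheta.
by move=> [mr mi]; split;
  [exact: (measurableT_comp mr mT)|exact: (measurableT_comp mi mT)].
Qed.

Lemma L2sqnorm_shear (F : XS -> R[i]) : cmeasurable F ->
  L2sqnorm munu (F \o shear Theta) = L2sqnorm munu F.
Proof.
move=> mF; rewrite !L2sqnormE.
have f0 : {in setT, forall p, (0 <= (sqc (F p))%:E)%E}.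
  by move=> p _; rewrite lee_fin sqc_ge0.
have := ge0_integral_pushforward (measurable_shear cTheta) munu measurableT
  (measurable_sqcE mF) f0.
rewrite preimage_setT => <-.
apply: eq_measure_integral => [|? E mE _]; first exact: (measurable_shear cTheta).
exact: shear_invariant.
Qed.

Lemma L2_shear F : L2 munu F -> L2 munu (F \o shear Theta).
Proof.
move=> [mF F2]; split; first exact: cmeasurable_shear.
by rewrite L2sqnorm_shear.
Qed.

Lemma L2_linear_action_change : L2_linear munu munu (action_change Theta).
Proof.
split => [F LF|F G LF LG FG|a F G LF LG]; [exact: L2_shear| |exact: aeW].
have [mF _] := LF; have [mG _] := LG.
(* Compatibility with almost everywhere equality comes from invariance, through the norm of the
   difference. *)
apply/(L2sqnorm_sub_eq0 _ (cmeasurable_shear mF) (cmeasurable_shear mG)).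
rewrite -[RHS]((L2sqnorm_sub_eq0 munu mF mG).2 FG).
exact: (L2sqnorm_shear (cmeasurable_lin (-1) mF mG)).
Qed.

End shear.

(** * Unitarity of the canonical map *)

Theorem proposition4p3 (R : realType) (n : nat)
    (Xi : normedModType R) (hdim : has_dimension Xi n.*2)
    (omega : Xi -> Xi -> R) (homega : is_symplectic_form omega)
    (mu : {sigma_finite_measure set (borel Xi) -> \bar R})
    (hmu : is_lebesgue mu)
    (Fou : (Xi -> R[i]) -> (Xi -> R[i]))
    (hFou : is_symplectic_fourier mu omega Fou)
    (hnormalized : L2_unitary mu mu Fou)
    (Sigma : ptopologicalType) (hhausdorff : hausdorff_space Sigma)
    (hloccompact : locally_compact [set: Sigma])
    (Theta : Xi -> Sigma -> Sigma) (hTheta : is_continuous_action Theta)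
    (nu : {measure set (borel Sigma) -> \bar R})
    (hradon : is_radon nu) (hinvariant : is_invariant Theta nu) :
  let munu := prod_measure mu nu in
  let M := canonical_map mu nu Fou Theta in
  (forall F G, L2 munu F -> L2 munu G ->
     L2dot munu (M F) (M G) = L2dot munu F G) /\
  L2_unitary munu munu M.
Proof.
move=> munu M; have [_ mu_compact _] := hmu; have [T0 TD cT] := hTheta.
have [Tlin Tnorm Tsurj] := tensor_id_unitary nu hnormalized.
have Clin := L2_linear_action_change hdim hhausdorff mu_compact hradon hTheta hinvariant.
have Cnorm F : L2 munu F -> L2sqnorm munu (action_change Theta F) = L2sqnorm munu F.
  move=> [mF _].
  exact: (L2sqnorm_shear hdim hhausdorff mu_compact hradon hTheta hinvariant mF).
have LC F : L2 munu F -> L2 munu (action_change Theta F).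
  exact: (L2_linear_L2 Clin).
have Mlin : L2_linear munu munu M.
  have [_ Tae _] := Tlin; have [_ Cae _] := Clin; split.
  - by move=> F /LC; exact: (L2_linear_L2 Tlin).
  - by move=> F G LF LG FG; apply: Tae; [exact: LC|exact: LC|exact: Cae].
  - by move=> a F G /LC LF /LC LG; exact: (L2_linear_lin Tlin a LF LG).
have Mnorm F : L2 munu F -> L2sqnorm munu (M F) = L2sqnorm munu F.
  by move=> LF; rewrite -(Cnorm F LF); exact: (Tnorm _ (LC F LF)).
(* Norm preservation composes directly from the two factors; polarization turns it into the
   orthogonality relations. *)
have Mdot := L2_norm_preserving_dot Mlin Mnorm.
split => //; split => // H /Tsurj[F LF FH].
have hTheta' : is_continuous_action (fun X => Theta (- X)).
  split; [by move=> s; rewrite oppr0|by move=> X Y s; rewrite opprD|].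
  exact: (continuous_opp_action hTheta).
(* A preimage [F] of [H] under the tensor operator is pulled back by the inverse shear. The shears
   cancel pointwise, so the tensor operator receives exactly [F], not just a function almost
   everywhere equal to it. *)
exists (F \o shear (fun X => Theta (- X))).
  exact: (L2_shear hdim hhausdorff mu_compact hradon hTheta'
    (invariant_opp_action hinvariant) LF).
rewrite (_ : M _ = tensor_id mu nu Fou F)//.
congr (tensor_id mu nu Fou _); apply/funext => p.
by congr F; exact: (shearK hTheta).
Qed.
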